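(* Let $X$ be a finite CW-complex and let $\pi:V\to X$ be an $\mathrm{Sp}_{2k}(\mathbb R)$-bundle over $X$, with its induced real symplectic form $\omega$. Let $S$ be a nullhomotopic symplectic vector bundle automorphism of $V$. Then there exist finitely many unipotent symplectic vector bundle automorphisms $E_1,\dots,E_N$ of $V$ such that $$S=E_N\circ\cdots\circ E_1 .$$ Moreover, the $E_j$ can be chosen such that for all $j$, on every fiber, $(E_j-\mathrm{id})^2=0$ and $\mathrm{rank}(E_j-\mathrm{id})\in\{0,1,2\}$; and if $V$ is Lagrangian, with Lagrangian splitting $V=L_1\oplus L_2$, one may in addition achieve that the $E_j$ respect the Lagrangian splitting.
   Context: $\mathrm{Sp}_{2k}(\mathbb R)$ is the group of real $2k\times 2k$-matrices preserving the standard symplectic form on $\mathbb R^{2k}$ (given by the matrix $\begin{bmatrix}0&\mathrm{Id}_k\\-\mathrm{Id}_k&0\end{bmatrix}$). An $\mathrm{Sp}_{2k}(\mathbb R)$-bundle is a real vector bundle of rank $2k$ together with a family of local trivializations covering $X$ whose transition functions take values in $\mathrm{Sp}_{2k}(\mathbb R)$. It carries the symplectic form $\omega$ (a non-degenerate section of $\Lambda^2V^*$) given by the standard symplectic form in any trivialization of the family. If in addition all transition matrices have block form $\begin{bmatrix}A&0\\0&B\end{bmatrix}$ (with $k\times k$ blocks), $V$ is called Lagrangian; then $V=L_1\oplus L_2$, where $L_1,L_2$ are the Lagrangian subbundles corresponding to the first and last $k$ coordinates. A vector bundle automorphism of $V$ is a homeomorphism $S:V\to V$ covering the identity of $X$ and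 linear on each fiber; it is symplectic if it preserves $\omega$, and unipotent if it is unipotent on every fiber ($(S-\mathrm{id})^m=0$ for some $m$). A symplectic vector bundle automorphism $S$ is nullhomotopic if there is a (jointly continuous) homotopy $S_t$, $t\in[0,1]$, of symplectic vector bundle automorphisms with $S_0=\mathrm{id}$ and $S_1=S$. $E_j$ respects the Lagrangian splitting if there is $i\in\{1,2\}$ such that at every point $x\in X$ the map $E_j$ on $V_x$ can be written as $E_j(u)=u+\omega(u,v)\,w+\omega(u,w)\,v$ with $v,w\in (L_i)_x$ (so that $\omega(v,w)=0$). *)

(* Defs.v *)
From HB Require Import structures.
From mathcomp Require Import all_boot all_order all_algebra.
From mathcomp Require Import all_classical all_reals all_analysis.

Set Implicit Arguments.
Unset Strict Implicit.
Unset Printing Implicit Defensive.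

Import Order.TTheory GRing.Theory Num.Theory.
Import numFieldNormedType.Exports.

Local Open Scope classical_set_scope.
Local Open Scope ring_scope.

Definition homeomorphism (T U : topologicalType) (f : T -> U) : Prop :=
  continuous f /\
  exists g : U -> T, [/\ continuous g, cancel f g & cancel g f].

Section Disks.
Variables (R : realType) (n : nat).

(* The norm of the library on 'rV[R]_n is the sup norm, hence the explicit
   Euclidean one here. *)
Definition sqnorm (v : 'rV[R]_n) : R := \sum_(i < n) v ord0 i ^+ 2.
Definition disk : set 'rV[R]_n := [set v | sqnorm v <= 1].
Definition open_disk : set 'rV[R]_n := [set v | sqnorm v < 1].
Definition sphere : set 'rV[R]_n := [set v | sqnorm v = 1].

End Disks.

Arguments disk : clear implicits.
Arguments open_disk : clear implicits.
Arguments sphere : clear implicits.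

(* CW structures with finitely many cells, presented by characteristic maps;
   char is only relevant on the closed disk. *)
Record finite_CW (R : realType) (X : topologicalType) := FiniteCW {
  cell : finType;
  cell_dim : cell -> nat;
  char : forall c : cell, 'rV[R]_(cell_dim c) -> X;
  CW_hausdorff : hausdorff_space X;
  char_continuous : forall c, {within disk R (cell_dim c), continuous (@char c)};
  char_inj : forall c, {in open_disk R (cell_dim c) &, injective (@char c)};
  open_cells_partition :
    forall x : X, exists! c : cell, (@char c @` open_disk R (cell_dim c)) x;
  char_boundary : forall c,
    @char c @` sphere R (cell_dim c) `<=`
      \bigcup_(c' in [set c' | (cell_dim c' < cell_dim c)%N])
        (@char c' @` open_disk R (cell_dim c'));
  CW_weak_topology : forall A : set X,
    (forall c, closed (disk R (cell_dim c) `&` @char c @^-1` A)) -> closed A }.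

Section StandardSymplectic.
Variables (R : realType) (k : nat).

Definition std_J : 'M[R]_(k + k) := block_mx 0 1%:M (- 1%:M) 0.

Definition std_omega (u v : 'cV[R]_(k + k)) : R :=
  (u^T *m std_J *m v) ord0 ord0.

Definition Sp : set 'M[R]_(k + k) := [set A | A^T *m std_J *m A = std_J].

Definition block_diagonal : set 'M[R]_(k + k) :=
  [set M | exists A B : 'M[R]_k, M = block_mx A 0 0 B].

End StandardSymplectic.

(* A family of finite-dimensional vector spaces over X together with a topology
   on its total space.  This topology is a datum; it is unrelated to the
   disjoint-union topology of the library on sigma types. *)
Record vect_family (R : realType) (X : topologicalType) := VectFamily {
  fib : X -> vectType R;
  tot_open : set (set {x : X & fib x});
  tot_openT : tot_open setT;
  tot_openI : forall A B, tot_open A -> tot_open B -> tot_open (A `&` B);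
  tot_open_bigcup : forall (I : Type) (F : I -> set {x : X & fib x}),
    (forall i, tot_open (F i)) -> tot_open (\bigcup_i F i) }.

Definition total (R : realType) (X : topologicalType) (V : vect_family R X) :=
  {x : X & fib V x}.

HB.instance Definition _ (R : realType) (X : topologicalType)
    (V : vect_family R X) := Choice.on (total V).
HB.instance Definition _ (R : realType) (X : topologicalType)
    (V : vect_family R X) :=
  isOpenTopological.Build (total V)
    (tot_openT V) (@tot_openI _ _ V) (@tot_open_bigcup _ _ V).

Section Total.
Variables (R : realType) (X : topologicalType) (V : vect_family R X).

Definition pt (x : X) (v : fib V x) : total V := existT (fun x => fib V x) x v.
Definition proj (e : total V) : X := projT1 e.
Definition vec (e : total V) : fib V (proj e) := projT2 e.

Lemma open_totalE (A : set (total V)) : open A = tot_open A.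
Proof. by []. Qed.

(* phi x matters only for x in U; the map (x, v) |-> (x, phi x v) is required to
   be a homeomorphism from the preimage of U onto U x R^n, linear on fibers. *)
Definition local_trivialization (n : nat) (U : set X)
    (phi : forall x, 'Hom(fib V x, 'cV[R]_n)) : Prop :=
  [/\ open U,
      forall x, U x -> lker (phi x) = 0%VS /\ limg (phi x) = fullv,
      {within proj @^-1` U,
        continuous (fun e : total V => (proj e, phi (proj e) (vec e)))}
    & {within U `*` setT,
        continuous (fun p : X * 'cV[R]_n => pt ((phi p.1)^-1%VF p.2))}].

(* phi o psi^-1 over the point x, as a matrix acting on column vectors *)
Definition transition (n : nat)
    (phi psi : forall x, 'Hom(fib V x, 'cV[R]_n)) (x : X) : 'M[R]_n :=
  \matrix_(a, b) (phi x ((psi x)^-1%VF (delta_mx b ord0))) a ord0.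

End Total.

Record sp_bundle (R : realType) (k : nat) (X : topologicalType) := SpBundle {
  bundle :> vect_family R X;
  proj_continuous : continuous (@proj R X bundle);
  triv_idx : Type;
  dom : triv_idx -> set X;
  triv : triv_idx -> forall x : X, 'Hom(fib bundle x, 'cV[R]_(k + k));
  dom_cover : forall x : X, exists i, dom i x;
  triv_local : forall i, local_trivialization (dom i) (triv i);
  transition_Sp : forall i j x, dom i x -> dom j x ->
    Sp (transition (triv i) (triv j) x) }.

Definition lagrangian (R : realType) (k : nat) (X : topologicalType)
    (V : sp_bundle R k X) : Prop :=
  forall (i j : triv_idx V) (x : X), dom i x -> dom j x ->
    block_diagonal (transition (triv i) (triv j) x).

Section SpBundle.
Variables (R : realType) (k : nat) (X : topologicalType).
Variable V : sp_bundle R k X.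

(* an arbitrary trivialization of the family around x; see omegaE and
   lagr_subE for the independence of this choice *)
Definition chart (x : X) : triv_idx V := sval (cid (dom_cover V x)).

Definition omega (x : X) (u v : fib V x) : R :=
  std_omega (triv (chart x) x u) (triv (chart x) x v).

(* The fiber at x of L_1 (false: the last k coordinates vanish) and of
   L_2 (true: the first k coordinates vanish); meaningful for lagrangian V. *)
Definition lagr_sub (b : bool) (x : X) : set (fib V x) :=
  [set v | (if b then usubmx (triv (chart x) x v)
            else dsubmx (triv (chart x) x v)) = 0].

Lemma chartP x : dom (chart x) x.
Proof. by rewrite /chart; case: cid. Qed.

Lemma trivE (i j : triv_idx V) (x : X) (v : fib V x) : dom i x -> dom j x ->
  triv i x v = transition (triv i) (triv j) x *m triv j x v.
Proof.
move=> Ui Uj; set w := triv j x v.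
have [_ /(_ x Uj) [kj ij] _ _] := triv_local j.
have -> : v = ((triv j x)^-1)%VF w.
  by apply/esym; apply: lker0_lfunK; rewrite kj.
have wE : w = \sum_b w b ord0 *: delta_mx b ord0.
  rewrite {1}[w]matrix_sum_delta; apply: eq_bigr => b _.
  by rewrite big_ord1.
apply/colP => a; rewrite {1}wE !linear_sum summxE mxE; apply: eq_bigr => b _.
by rewrite !linearZ !mxE mulrC; congr (_ * _).
Qed.

Lemma omegaE (i : triv_idx V) (x : X) (u v : fib V x) : dom i x ->
  omega u v = std_omega (triv i x u) (triv i x v).
Proof.
move=> Ui; rewrite /omega /std_omega.
rewrite !(trivE _ (chartP x) Ui) trmx_mul.
set A := transition _ _ x.
have AJ : A^T *m std_J R k *m A = std_J R k.
  exact: (transition_Sp (chartP x) Ui).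
by rewrite -{2}AJ !mulmxA.
Qed.

Lemma lagr_subE (b : bool) (i : triv_idx V) (x : X) (v : fib V x) :
  lagrangian V -> dom i x ->
  lagr_sub b v <->
  (if b then usubmx (triv i x v) else dsubmx (triv i x v)) = 0.
Proof.
move=> LV Ui.
suff H j l : dom j x -> dom l x ->
    (if b then usubmx (triv j x v) else dsubmx (triv j x v)) = 0 ->
    (if b then usubmx (triv l x v) else dsubmx (triv l x v)) = 0.
  by split; apply: H => //; exact: chartP.
move=> Uj Ul; rewrite (trivE _ Ul Uj); have [A [B ->]] := LV l j x Ul Uj.
rewrite -[triv j x v]vsubmxK mul_block_col !mul0mx addr0 add0r.
by case: b; rewrite ?col_mxKu ?col_mxKd => ->; rewrite mulmx0.
Qed.

(* An endomorphism of V covering the identity of X is given by its fibers. *)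
Definition vb_end := forall x : X, 'End(fib V x).

Definition total_map (S : vb_end) (e : total V) : total V :=
  pt (S (proj e) (vec e)).

Definition vb_automorphism (S : vb_end) : Prop := homeomorphism (total_map S).

Definition symplectic (S : vb_end) : Prop :=
  forall (x : X) (u v : fib V x), omega (S x u) (S x v) = omega u v.

Definition symplectic_automorphism (S : vb_end) : Prop :=
  vb_automorphism S /\ symplectic S.

Definition unipotent (S : vb_end) : Prop :=
  forall x : X, exists m : nat,
    forall v : fib V x, iter m (fun w => (S x - \1)%VF w) v = 0.

Definition nullhomotopic (S : vb_end) : Prop :=
  exists H : R -> vb_end,
    [/\ forall t, 0 <= t <= 1 -> symplectic_automorphism (H t),
        {within [set p : R * total V | 0 <= p.1 <= 1],
          continuous (fun p : R * total V => total_map (H p.1) p.2)},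
        forall x, H 0 x = \1%VF
      & forall x, H 1 x = S x].

Definition respects_splitting (E : vb_end) : Prop :=
  exists b : bool, forall x : X, exists v w : fib V x,
    [/\ lagr_sub b v, lagr_sub b w
      & forall u, E x u = u + omega u v *: w + omega u w *: v].

Fixpoint vb_comp (E : nat -> vb_end) (N : nat) (x : X) : 'End(fib V x) :=
  if N is n.+1 then (E n x \o vb_comp E n x)%VF else \1%VF.

Definition elementary (E : vb_end) : Prop :=
  forall x : X,
    ((E x - \1) \o (E x - \1))%VF = 0 /\
    \dim (limg (E x - \1)%VF) \in [:: 0; 1; 2]%N.

End SpBundle.

(* Main.v *)
(* X enters only through being compact and Hausdorff.  Let H_t be a homotopy from
   the identity to S.  For continuous tau : X -> [0, 1], consider the
   automorphism x |-> H_(tau x) at x.  Starting from tau = 0, enlarge tau by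
   bump functions whose 1-sets cover X until tau = 1, each time in small
   increments.  One increment from sigma to tau, supported in a chart, multiplies
   by A = H_tau H_sigma^-1, a symplectic matrix function close to 1.

   Near 1, A = [[1, 0], [Y, 1]] diag(P, P^-T) [[1, Z], [0, 1]] with Y, Z symmetric.
   The first j columns of P, completed by the identity, form matrices P_j with
   P_(j+1) = P_j (1 + c_j e_j^T), so P is the product of the 1 + c_j e_j^T, and each
   of these is a product P' Q'^-1 (1 + e_j e_j^T)^-1 with P', Q' symmetric.  For
   symmetric P, Q one has diag(P Q^-1, P^-1 Q) = w(P) w(-Q), where
   w(P) = [[1, P], [0, 1]] [[1, 0], [-P^-1, 1]] [[1, P], [0, 1]].  Hence A is a word
   in block shears by symmetric matrices depending continuously on A.

   The letters do not tend to 1 as A does, so they are multiplied by a cutoff chi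
   equal to 1 where sigma <> tau: elsewhere A = 1, and the word was chosen so that
   it evaluates to 1 at A = 1 for every value of chi. *)
Require Import Defs.
From HB Require Import structures.
From mathcomp Require Import all_boot all_order all_algebra.
From mathcomp Require Import all_classical all_reals all_analysis.
From mathcomp Require Import ring lra.
Import Order.TTheory GRing.Theory Num.Theory.
Import numFieldNormedType.Exports.
Local Open Scope classical_set_scope.
Local Open Scope ring_scope.

Set Implicit Arguments.
Unset Strict Implicit.
Unset Printing Implicit Defensive.

(** * Convergence of matrix-valued functions along a filter *)

Section MatrixContinuity.
Variable R : realType.

Lemma cvg_mxP (T : Type) (F : set_system T) (FF : Filter F) (m n : nat)
    (f : T -> 'M[R]_(m, n)) (A : 'M[R]_(m, n)) :
  f @ F --> A <-> forall i j, (fun t => f t i j) @ F --> A i j.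
Proof.
split=> [fA i j|fA B [P nP PB]].
  apply: (@cvg_comp _ _ _ f (fun M : 'M[R]_(m, n) => M i j) _ _ _ fA).
  exact: coord_continuous.
have : \forall t \near F, forall i j, P i j (f t i j).
  by apply: filter_forall => i; apply: filter_forall => j; exact: fA (nP i j).
by apply: filterS => t Pt; apply: PB.
Qed.

Section Cvg.
Variables (T : Type) (F : set_system T) (FF : Filter F).

Lemma cvg_mulmx (m n p : nat) (f : T -> 'M[R]_(m, n)) (g : T -> 'M[R]_(n, p))
    (A : 'M[R]_(m, n)) (B : 'M[R]_(n, p)) :
  f @ F --> A -> g @ F --> B -> (fun t => f t *m g t) @ F --> A *m B.
Proof.
move=> /(cvg_mxP FF) fA /(cvg_mxP FF) gB; apply/cvg_mxP => i j; rewrite mxE.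
under eq_fun do rewrite mxE.
by apply: cvg_big => [|l _]; [exact: add_continuous|exact: cvgM].
Qed.

Lemma cvg_addmx (m n : nat) (f g : T -> 'M[R]_(m, n)) (A B : 'M[R]_(m, n)) :
  f @ F --> A -> g @ F --> B -> (fun t => f t + g t) @ F --> A + B.
Proof.
move=> /(cvg_mxP FF) fA /(cvg_mxP FF) gB; apply/cvg_mxP => i j; rewrite mxE.
by under eq_fun do rewrite mxE; exact: cvgD.
Qed.

Lemma cvg_oppmx (m n : nat) (f : T -> 'M[R]_(m, n)) (A : 'M[R]_(m, n)) :
  f @ F --> A -> (fun t => - f t) @ F --> - A.
Proof.
move=> /(cvg_mxP FF) fA; apply/cvg_mxP => i j; rewrite mxE.
by under eq_fun do rewrite mxE; exact: cvgN.
Qed.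

Lemma cvg_scalemx (m n : nat) (a : T -> R) (f : T -> 'M[R]_(m, n)) (b : R)
    (A : 'M[R]_(m, n)) :
  a @ F --> b -> f @ F --> A -> (fun t => a t *: f t) @ F --> b *: A.
Proof.
move=> ab /(cvg_mxP FF) fA; apply/cvg_mxP => i j; rewrite mxE.
by under eq_fun do rewrite mxE; exact: cvgM.
Qed.

Lemma cvg_trmx (m n : nat) (f : T -> 'M[R]_(m, n)) (A : 'M[R]_(m, n)) :
  f @ F --> A -> (fun t => (f t)^T) @ F --> A^T.
Proof.
move=> /(cvg_mxP FF) fA; apply/cvg_mxP => i j; rewrite mxE.
by under eq_fun do rewrite mxE; exact: fA.
Qed.

Lemma cvg_block_mx (m1 m2 n1 n2 : nat)
    (f1 : T -> 'M[R]_(m1, n1)) (f2 : T -> 'M[R]_(m1, n2))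
    (f3 : T -> 'M[R]_(m2, n1)) (f4 : T -> 'M[R]_(m2, n2))
    (A1 : 'M[R]_(m1, n1)) (A2 : 'M[R]_(m1, n2))
    (A3 : 'M[R]_(m2, n1)) (A4 : 'M[R]_(m2, n2)) :
  f1 @ F --> A1 -> f2 @ F --> A2 -> f3 @ F --> A3 -> f4 @ F --> A4 ->
  (fun t => block_mx (f1 t) (f2 t) (f3 t) (f4 t) : 'M[R]_(m1 + m2, n1 + n2))
    @ F --> (block_mx A1 A2 A3 A4 : 'M[R]_(m1 + m2, n1 + n2)).
Proof.
move=> /(cvg_mxP FF) c1 /(cvg_mxP FF) c2 /(cvg_mxP FF) c3 /(cvg_mxP FF) c4.
apply/cvg_mxP => i j; case: (split_ordP i) => i' ->; case: (split_ordP j) => j' ->.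
- by rewrite block_mxEul; under eq_fun do rewrite block_mxEul; exact: c1.
- by rewrite block_mxEur; under eq_fun do rewrite block_mxEur; exact: c2.
- by rewrite block_mxEdl; under eq_fun do rewrite block_mxEdl; exact: c3.
- by rewrite block_mxEdr; under eq_fun do rewrite block_mxEdr; exact: c4.
Qed.

Lemma cvg_det (n : nat) (f : T -> 'M[R]_n) (A : 'M[R]_n) :
  f @ F --> A -> (fun t => \det (f t)) @ F --> \det A.
Proof.
move=> /(cvg_mxP FF) fA; apply: cvg_big => [|s _]; first exact: add_continuous.
apply: cvgM.
  exact: cvg_cst.
by apply: cvg_big => [|i _]; [exact: mul_continuous|exact: fA].
Qed.

Lemma near_unitmx (n : nat) (f : T -> 'M[R]_n) (A : 'M[R]_n) :
  f @ F --> A -> A \in unitmx -> \forall t \near F, f t \in unitmx.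
Proof.
move=> /cvg_det fA; rewrite unitmxE unitfE => A0.
have N0 : nbhs (\det A) [set d | d != 0].
  by apply: open_nbhs_nbhs; split => //; exact: open_neq.
have : F [set t | \det (f t) != 0] := fA _ N0.
by apply: filterS => t ft; rewrite unitmxE unitfE.
Qed.

Lemma cvg_invmx (n : nat) (f : T -> 'M[R]_n) (A : 'M[R]_n) :
  f @ F --> A -> A \in unitmx -> (fun t => invmx (f t)) @ F --> invmx A.
Proof.
move=> fA uA; have uf := near_unitmx fA uA.
(* [invmx] is defined by cases; near the limit only its invertible case occurs, where it is the
   adjugate divided by the determinant. *)
have E : {near F, (fun t => (\det (f t))^-1 *: \adj (f t)) =1
                 fun t => invmx (f t)}.
  by apply: filterS uf => t uft; rewrite /invmx uft.
apply: (cvg_trans (near_eq_cvg E)); rewrite /invmx uA; apply: cvg_scalemx.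
  apply: cvgV; last exact: cvg_det.
  by rewrite -unitfE -unitmxE.
move/(cvg_mxP FF) in fA.
apply/cvg_mxP => i j; rewrite mxE; under eq_fun do rewrite mxE.
apply: cvgM; first exact: cvg_cst.
apply: cvg_det; apply/cvg_mxP => a b; rewrite !mxE.
by under eq_fun do rewrite !mxE; exact: fA.
Qed.

End Cvg.
End MatrixContinuity.

(** * Block shears, the Levi subgroup and Weyl elements of the symplectic group *)

Section ShearAlgebra.
Variables (R : realType) (k : nat).
Implicit Types (P Q X Y Z : 'M[R]_k) (A : 'M[R]_(k + k)).

(** As in [lagr_sub], [b] selects the Lagrangian summand containing the image of [shear b Z - 1];
    [true] stands for the last k coordinates. *)
Definition shear (b : bool) Z : 'M[R]_(k + k) :=
  if b then block_mx 1%:M 0 Z 1%:M else block_mx 1%:M Z 0 1%:M.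

Lemma shear0 b : shear b 0 = 1%:M.
Proof. by case: b; rewrite /shear [RHS]scalar_mx_block. Qed.

Lemma shearD b Y Z : shear b (Y + Z) = shear b Y *m shear b Z.
Proof.
by case: b; rewrite /shear mulmx_block !(mul1mx, mulmx1, mul0mx, mulmx0);
  rewrite !(addr0, add0r) // addrC.
Qed.

Lemma shear_Sp b Z : Z^T = Z -> Sp (shear b Z).
Proof.
move=> sZ; rewrite /Sp /std_J /=; case: b;
  rewrite /shear tr_block_mx !mulmx_block !(trmx0, trmx1, sZ);
  by rewrite !(mul1mx, mulmx1, mul0mx, mulmx0, mulNmx, mulmxN, oppr0, addr0,
    add0r, addrN, addNr).
Qed.

Lemma Sp_unitmx A : Sp A -> A \in unitmx.
Proof.
rewrite /Sp /= => SA.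
have J2 : std_J R k *m std_J R k = - 1%:M.
  rewrite /std_J mulmx_block !(mul1mx, mulmx1, mul0mx, mulmx0).
  by rewrite !(addr0, add0r) [in RHS]scalar_mx_block opp_block_mx oppr0.
have : (- (std_J R k *m A^T *m std_J R k)) *m A = 1%:M.
  by rewrite mulNmx -!mulmxA (mulmxA A^T) SA J2 opprK.
by case/mulmx1_unit.
Qed.

Lemma SpM A (B : 'M[R]_(k + k)) : Sp A -> Sp B -> Sp (A *m B).
Proof.
rewrite /Sp /= => SA SB.
by rewrite trmx_mul -!mulmxA (mulmxA (std_J R k)) (mulmxA A^T) (mulmxA A^T) SA
  mulmxA SB.
Qed.

Lemma SpV A : Sp A -> Sp (invmx A).
Proof.
move=> SA; have uA := Sp_unitmx SA; move: SA; rewrite /Sp /= => SA.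
by rewrite -{1}SA !mulmxA -trmx_mul mulmxV // trmx1 mul1mx mulmxK.
Qed.

Lemma invmxM P Q : P \in unitmx -> Q \in unitmx ->
  invmx (P *m Q) = invmx Q *m invmx P.
Proof.
move=> uP uQ; have uPQ : P *m Q \in unitmx by rewrite unitmx_mul uP.
apply: (can_inj (mulKmx uPQ)).
by rewrite mulmxV // mulmxA -(mulmxA P) (mulmxV uQ) mulmx1 mulmxV.
Qed.

(** The embedding of GL_k into Sp_2k as Levi factor of the stabilizer of a Lagrangian subspace. *)
Definition levi P : 'M[R]_(k + k) := block_mx P 0 0 (invmx P)^T.

Lemma leviM P Q : P \in unitmx -> Q \in unitmx ->
  levi (P *m Q) = levi P *m levi Q.
Proof.
move=> uP uQ; rewrite /levi mulmx_block !(mul0mx, mulmx0, addr0, add0r).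
by rewrite invmxM // trmx_mul.
Qed.

(** Block LDU decomposition. The blocks of A^T J A = J give in turn: P^T Y P is symmetric, hence Y
    is; the lower right block of A is Y P Z + P^-T; and with this value Z is symmetric. *)
Lemma Sp_shear_decomposition A : Sp A -> ulsubmx A \in unitmx ->
  let P := ulsubmx A in
  let Y := dlsubmx A *m invmx P in let Z := invmx P *m ursubmx A in
  [/\ Y^T = Y, Z^T = Z & A = shear true Y *m (levi P *m shear false Z)].
Proof.
move=> SA uP P Y Z.
have [EP EQ ER] : [/\ P = ulsubmx A, ursubmx A = P *m Z & dlsubmx A = Y *m P].
  by rewrite /Z /Y mulmxA mulmxV // mul1mx mulmxKV.
set T := drsubmx A.
have AE : A = block_mx P (P *m Z) (Y *m P) T.
  by rewrite -EQ -ER /P /T submxK.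
rewrite -/P in uP; clear EP EQ ER; clearbody P Y Z T.
move: SA; rewrite /Sp /= {1 2}AE /std_J tr_block_mx !mulmx_block.
rewrite !(mul1mx, mulmx1, mul0mx, mulmx0, mulNmx, mulmxN, addr0, add0r).
move=> /eq_block_mx [E1 E2 _ E4].
have uPt : P^T \in unitmx by rewrite unitmx_tr.
have sY : Y^T = Y.
  apply: (can_inj (mulKmx uPt)); apply: (can_inj (mulmxK uP)).
  apply/eqP; rewrite eq_sym -subr_eq0 addrC -[P^T *m Y^T]trmx_mul.
  by rewrite -(mulmxA P^T) E1.
have TE : T = Y *m P *m Z + (invmx P)^T.
  apply: (can_inj (mulKmx uPt)).
  rewrite mulmxDr -[P^T *m _^T]trmx_mul mulVmx // trmx1 -E2 trmx_mul sY.
  by rewrite !mulmxA addrA subrr add0r.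
have sZ : Z^T = Z.
  have TZ : T^T *m (P *m Z) = Z^T *m P^T *m Y *m P *m Z + Z.
    rewrite TE linearD /= !trmx_mul sY trmxK mulmxDl !mulmxA.
    by rewrite mulVmx // mul1mx.
  have ZT : (P *m Z)^T *m T = Z^T *m P^T *m Y *m P *m Z + Z^T.
    rewrite TE mulmxDr !mulmxA trmx_mul -(mulmxA Z^T P^T (invmx P)^T).
    by rewrite -[P^T *m (invmx P)^T]trmx_mul mulVmx // trmx1 mulmx1.
  move/eqP: E4; rewrite TZ ZT opprD addrACA addNr add0r addrC subr_eq0.
  by move/eqP.
split=> //.
by rewrite [LHS]AE TE mulmxA.
Qed.

Definition weyl (chi : R) P := shear false (chi *: P) *m
  (shear true (chi *: - invmx P) *m shear false (chi *: P)).

Lemma weyl1E P : P \in unitmx -> weyl 1 P = block_mx 0 P (- invmx P) 0.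
Proof.
move=> uP; rewrite /weyl !scale1r.
have -> : shear true (- invmx P) *m shear false P =
    block_mx 1%:M P (- invmx P) 0.
  rewrite /shear mulmx_block !(mul1mx, mulmx1, mul0mx, mulmx0, addr0, mulNmx).
  by rewrite mulVmx // addNr.
rewrite /shear mulmx_block !(mul1mx, mul0mx, mulmx0, addr0, add0r, mulmxN).
by rewrite mulmxV // addrN.
Qed.

Lemma invmxN P : invmx (- P) = - invmx P.
Proof.
have [uP|uP] := boolP (P \in unitmx).
  by rewrite -scaleN1r invmxZ ?unitmxZ ?unitrN1 // invrN1 scaleN1r.
by rewrite /invmx -scaleN1r unitmxZ ?unitrN1 // (negPf uP) scaleN1r.
Qed.

(** The word of [weyl] is a palindrome and negating P negates each of its letters, so the second
    factor is the first one read backwards with inverted letters. This cancellation holds for every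
    cutoff value, not only where [weyl] is a Weyl element. *)
Lemma weylN chi P : weyl chi P *m weyl chi (- P) = 1%:M.
Proof.
have shearNr b Z : shear b Z *m shear b (- Z) = 1%:M.
  by rewrite -shearD subrr shear0.
rewrite /weyl invmxN !scalerN opprK -!mulmxA (mulmxA (shear false (chi *: P))
  (shear false _)) shearNr mul1mx (mulmxA (shear true _) (shear true _)).
by rewrite -[X in shear true _ *m shear true X]opprK shearNr mul1mx shearNr.
Qed.

(** By [weyl1E] both factors are block antidiagonal, so the product is diag(P Q^-1, P^-1 Q);
    symmetry of P and Q makes the second block the inverse transpose of the first. *)
Lemma weylMN P Q : P \in unitmx -> Q \in unitmx -> P^T = P -> Q^T = Q ->
  weyl 1 P *m weyl 1 (- Q) = levi (P *m invmx Q).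
Proof.
move=> uP uQ sP sQ; have uNQ : - Q \in unitmx by rewrite -scaleN1r unitmxZ ?unitrN1.
rewrite /levi; have -> : invmx (P *m invmx Q) = Q *m invmx P.
  by rewrite invmxM ?unitmx_inv // invmxK.
rewrite !weyl1E // mulmx_block trmx_mul trmx_inv sP sQ.
rewrite invmxN.
by rewrite !(mul0mx, mulmx0, addr0, add0r, opprK, mulmxN, mulNmx).
Qed.

End ShearAlgebra.

(** * Column operations as ratios of symmetric matrices *)

Section ColumnFactors.
Variables (R : realType) (k : nat).
Implicit Types (P : 'M[R]_k) (c : 'cV[R]_k) (j : 'I_k).

Local Notation e j := (delta_mx j ord0 : 'cV[R]_k).

(** A symmetric matrix Q with Q e_j = u, where u = e_j + 2 c, and Q = 1 at c = 0. Then (1 + u e_j^T)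
    Q = Q + u u^T is symmetric as well; this is [col_num]. The shift by e_j keeps u away from 0 when
    c tends to 0. *)
Definition col_den j c : 'M[R]_k :=
  1%:M + 2%:R *: (c *m (e j)^T + e j *m c^T)
  - (2%:R * c j ord0) *: (e j *m (e j)^T).

Definition col_num j c : 'M[R]_k :=
  col_den j c + (2%:R *: c + e j) *m (2%:R *: c + e j)^T.

Definition unit_num j : 'M[R]_k := 1%:M + e j *m (e j)^T.

Lemma col_den_sym j c : (col_den j c)^T = col_den j c.
Proof.
rewrite /col_den !(linearB, linearD, linearZ) /= trmx1 !linearD /=.
by rewrite !trmx_mul !trmxK; congr (_ + _ + _); exact: addrC.
Qed.

Lemma col_num_sym j c : (col_num j c)^T = col_num j c.
Proof. by rewrite /col_num linearD /= col_den_sym trmx_mul trmxK. Qed.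

Lemma unit_num_sym j : (unit_num j)^T = unit_num j.
Proof. by rewrite /unit_num linearD /= trmx1 trmx_mul trmxK. Qed.

Lemma col_den0 j : col_den j 0 = 1%:M.
Proof.
by rewrite /col_den mxE trmx0 mul0mx mulmx0 addr0 scaler0 mulr0 scale0r subr0
  addr0.
Qed.

Lemma col_num0 j : col_num j 0 = unit_num j.
Proof. by rewrite /col_num col_den0 scaler0 add0r. Qed.

Lemma trmx_e_mul j c : (e j)^T *m c = (c j ord0)%:M.
Proof.
rewrite trmx_delta; apply/matrixP => a b; rewrite !ord1 !mxE (bigD1 j) //= big1.
  by rewrite !mxE !eqxx mul1r addr0.
by move=> i /negPf ij; rewrite !mxE ij andbF mul0r.
Qed.

Lemma delta_diag j : e j j ord0 = 1.
Proof. by rewrite mxE !eqxx. Qed.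

Lemma unit_num_unit j : unit_num j \in unitmx.
Proof.
(* E = e_j e_j^T is idempotent, so (1 + E)(1 - E/2) = 1. *)
suff : unit_num j *m (1%:M - 2%:R^-1 *: (e j *m (e j)^T)) = 1%:M.
  by case/mulmx1_unit.
rewrite /unit_num mulmxDl mul1mx mulmxBr mulmx1 -scalemxAr -mulmxA.
rewrite (mulmxA (e j)^T) trmx_e_mul delta_diag mul1mx.
by move: (e j *m _) => E; apply/matrixP => a b; rewrite !mxE; field.
Qed.

Lemma col_num_factor j c : col_num j c = (1%:M + (2%:R *: c + e j) *m (e j)^T)
  *m col_den j c.
Proof.
rewrite mulmxDl mul1mx /col_num -mulmxA; congr (_ + _ *m _).
rewrite -[RHS]trmxK [in RHS]trmx_mul trmxK col_den_sym; congr trmx.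
rewrite /col_den mulmxBl mulmxDl mul1mx -!scalemxAl mulmxDl -!mulmxA.
rewrite trmx_e_mul (_ : c^T *m e j = ((e j)^T *m c)^T); last first.
  by rewrite trmx_mul trmxK.
rewrite trmx_e_mul tr_scalar_mx delta_diag !mulmx1 mul_mx_scalar scalerDr.
by rewrite scalerA addrA addrK addrC.
Qed.

(** The first ratio is 1 + (2 c + e_j) e_j^T = (1 + c e_j^T)(1 + e_j e_j^T), and the second one
    removes the last factor. The second is also written as a ratio, because at c = 0 its numerator
    and denominator are those of the first ratio interchanged. *)
Lemma col_factor j c : col_den j c \in unitmx ->
  1%:M + c *m (e j)^T =
  (col_num j c *m invmx (col_den j c)) *m (1%:M *m invmx (unit_num j)).
Proof.
move=> uQ; rewrite mul1mx col_num_factor mulmxK //.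
apply: (can_inj (mulmxK (unit_num_unit j))); rewrite mulmxKV ?unit_num_unit //.
rewrite /unit_num mulmxDl mul1mx mulmxDr mulmx1 -!mulmxA (mulmxA (e j)^T).
rewrite trmx_e_mul delta_diag mul1mx -addrA; congr (_ + _).
rewrite mulmxDl -scalemxAl.
by move: (c *m _) (e j *m _) => Y Z; apply/matrixP => a b; rewrite !mxE; ring.
Qed.

Definition first_cols n P : 'M[R]_k :=
  \matrix_(a, b) if (b < n)%N then P a b else (a == b)%:R.

Lemma first_cols0 P : first_cols 0 P = 1%:M.
Proof. by apply/matrixP => a b; rewrite !mxE. Qed.

Lemma first_cols_all P : first_cols k P = P.
Proof. by apply/matrixP => a b; rewrite !mxE ltn_ord. Qed.

Lemma first_cols1 n : first_cols n 1%:M = 1%:M.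
Proof. by apply/matrixP => a b; rewrite !mxE; case: ifP. Qed.

Definition col_coef j P : 'cV[R]_k := invmx (first_cols j P) *m col j (P - 1%:M).

Lemma col_coef1 j : col_coef j 1%:M = 0.
Proof. by rewrite /col_coef subrr col0 mulmx0. Qed.

(** Column j of [first_cols j P] is still e_j. Adding (P - 1) e_j to it gives column j of P, and
    [col_coef] is this correction pulled back through [first_cols j P]. *)
Lemma first_colsS j P : first_cols j P \in unitmx ->
  first_cols j.+1 P = first_cols j P *m (1%:M + col_coef j P *m (e j)^T).
Proof.
move=> uP; rewrite mulmxDr mulmx1 !mulmxA mulmxV // mul1mx trmx_delta.
apply/matrixP => a b; rewrite !mxE big_ord1 !mxE eqxx /= ltnS leq_eqVlt.
have -> : (b == j) = (b == j :> nat) by [].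
case: ltngtP => bj /=; rewrite ?mulr0 ?addr0 ?mulr1 //.
by rewrite (val_inj bj) addrC subrK.
Qed.

End ColumnFactors.

(** * Continuous words in shears for symplectic matrices near the identity *)

Section ShearWords.
Variables (R : realType) (k : nat).
Local Notation mxkk := 'M[R]_(k + k).

(* A word [:: (b1, Y1); ...] stands for the product of the shears by the
   symmetric matrices Yi A + (Yi A)^T; chi is the value of a cutoff. *)
Definition word := seq (bool * (mxkk -> 'M[R]_k)).

Definition letter_mx (chi : R) (A : mxkk) (l : bool * (mxkk -> 'M[R]_k)) :=
  shear l.1 (chi *: (l.2 A + (l.2 A)^T)).

Definition word_mx (chi : R) (s : word) (A : mxkk) : mxkk :=
  foldr (fun l M => letter_mx chi A l *m M) 1%:M s.

Fixpoint word_continuous_at (A : mxkk) (s : word) : Prop :=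
  if s is l :: s' then l.2 @ A --> l.2 A /\ word_continuous_at A s' else True.

Lemma word_mx_cat chi s1 s2 A :
  word_mx chi (s1 ++ s2) A = word_mx chi s1 A *m word_mx chi s2 A.
Proof.
by elim: s1 => [|l s IH] /=; rewrite ?mul1mx // IH mulmxA.
Qed.

Lemma word_continuous_at_cat A s1 s2 : word_continuous_at A s1 ->
  word_continuous_at A s2 -> word_continuous_at A (s1 ++ s2).
Proof. by elim: s1 => [|l s IH] //= [? ?] ?; split => //; exact: IH. Qed.

(** Continuity at all points of a neighbourhood of 1: the words are later evaluated at a matrix
    function on the base whose values are only close to 1. *)
Definition cont_near1 m n (f : mxkk -> 'M[R]_(m, n)) :=
  \forall A \near (1%:M : mxkk), f @ A --> f A.

Lemma near1S (P Q : mxkk -> Prop) : (forall A, P A -> Q A) ->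
  (\forall A \near (1%:M : mxkk), P A) -> \forall A \near (1%:M : mxkk), Q A.
Proof. by move=> PQ; exact: filterS. Qed.

Lemma near1S2 (P P' Q : mxkk -> Prop) : (forall A, P A -> P' A -> Q A) ->
  (\forall A \near (1%:M : mxkk), P A) -> (\forall A \near (1%:M : mxkk), P' A) ->
  \forall A \near (1%:M : mxkk), Q A.
Proof. by move=> PQ; exact: filterS2. Qed.

Lemma near1E (Q : mxkk -> Prop) : (forall A, Q A) ->
  \forall A \near (1%:M : mxkk), Q A.
Proof. by move=> PQ; exact: filterE. Qed.

Lemma cont_near1_at m n (f : mxkk -> 'M[R]_(m, n)) :
  cont_near1 f -> f @ (1%:M : mxkk) --> f 1%:M.
Proof. exact: nbhs_singleton. Qed.

Lemma cont_near1_cst m n (B : 'M[R]_(m, n)) : cont_near1 (fun=> B).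
Proof.
by rewrite /cont_near1; apply: near1E => A; exact: (@cvg_cst _ _ _ (nbhs A)).
Qed.

Lemma cont_near1_mul m n p (f : mxkk -> 'M[R]_(m, n)) (g : mxkk -> 'M[R]_(n, p)) :
  cont_near1 f -> cont_near1 g -> cont_near1 (fun A => f A *m g A).
Proof.
by rewrite /cont_near1; apply: near1S2 => A fA gA;
  exact: (cvg_mulmx (nbhs_filter A)).
Qed.

Lemma cont_near1_add m n (f g : mxkk -> 'M[R]_(m, n)) :
  cont_near1 f -> cont_near1 g -> cont_near1 (fun A => f A + g A).
Proof.
by rewrite /cont_near1; apply: near1S2 => A fA gA;
  exact: (cvg_addmx (nbhs_filter A)).
Qed.

Lemma cont_near1_opp m n (f : mxkk -> 'M[R]_(m, n)) :
  cont_near1 f -> cont_near1 (fun A => - f A).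
Proof.
by rewrite /cont_near1; apply: near1S => A fA; exact: (cvg_oppmx (nbhs_filter A)).
Qed.

Lemma cont_near1_scale m n a (f : mxkk -> 'M[R]_(m, n)) :
  cont_near1 f -> cont_near1 (fun A => a *: f A).
Proof.
rewrite /cont_near1; apply: near1S => A fA.
by apply: (cvg_scalemx (nbhs_filter A)) => //; exact: (@cvg_cst _ _ _ (nbhs A)).
Qed.

Lemma cont_near1_tr m n (f : mxkk -> 'M[R]_(m, n)) :
  cont_near1 f -> cont_near1 (fun A => (f A)^T).
Proof.
by rewrite /cont_near1; apply: near1S => A fA; exact: (cvg_trmx (nbhs_filter A)).
Qed.

Lemma cont_near1_unit n (f : mxkk -> 'M[R]_n) :
  cont_near1 f -> f 1%:M \in unitmx ->
  \forall A \near (1%:M : mxkk), f A \in unitmx.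
Proof. by move=> /cont_near1_at; exact: (near_unitmx (nbhs_filter (1%:M : mxkk))). Qed.

Lemma cont_near1_inv n (f : mxkk -> 'M[R]_n) :
  cont_near1 f -> f 1%:M \in unitmx -> cont_near1 (fun A => invmx (f A)).
Proof.
move=> cf /(cont_near1_unit cf); move: cf; rewrite /cont_near1.
by apply: near1S2 => A fA uA; exact: (cvg_invmx (nbhs_filter A)).
Qed.

(** The word represents M without cutoff on symplectic matrices near 1; at 1 itself it must collapse
    for all values of the cutoff, as the cutoff varies where the matrix is 1. *)
Definition shearable (M : mxkk -> mxkk) := exists s : word,
  [/\ \forall A \near (1%:M : mxkk), word_continuous_at A s,
      \forall A \near (1%:M : mxkk), Sp A -> word_mx 1 s A = M A
    & forall chi, word_mx chi s 1%:M = 1%:M].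

Lemma shearable_eq (M M' : mxkk -> mxkk) : shearable M ->
  (\forall A \near (1%:M : mxkk), Sp A -> M A = M' A) -> shearable M'.
Proof.
move=> [s [cs sM s1]] MM'; exists s; split => //.
by apply: near1S2 sM MM' => A sM MM' SA; rewrite sM ?MM'.
Qed.

Lemma shearable_mul (M M' : mxkk -> mxkk) : shearable M -> shearable M' ->
  shearable (fun A => M A *m M' A).
Proof.
move=> [s [cs sM s1]] [s' [cs' sM' s1']]; exists (s ++ s'); split.
- by apply: near1S2 cs cs' => A; exact: word_continuous_at_cat.
- by apply: near1S2 sM sM' => A sM sM' SA; rewrite word_mx_cat sM ?sM'.
- by move=> chi; rewrite word_mx_cat s1 s1' mulmx1.
Qed.

(** A letter adds the transpose of its matrix, so a symmetric matrix enters a word as its half. *)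
Lemma halvesK (Z : 'M[R]_k) : Z^T = Z -> 2%:R^-1 *: Z + (2%:R^-1 *: Z)^T = Z.
Proof.
move=> sZ; rewrite linearZ /= sZ -scalerDl [X in X *: _](_ : _ = 1) ?scale1r //.
by field.
Qed.

Lemma shearable_shear b (Z : mxkk -> 'M[R]_k) : cont_near1 Z -> Z 1%:M = 0 ->
  (\forall A \near (1%:M : mxkk), Sp A -> (Z A)^T = Z A) ->
  shearable (fun A => shear b (Z A)).
Proof.
move=> cZ Z1 sZ; exists [:: (b, fun A => 2%:R^-1 *: Z A)]; split.
- by have := cont_near1_scale 2%:R^-1 cZ; rewrite /cont_near1; apply: near1S.
- apply: near1S sZ => A sZ SA; rewrite /word_mx /letter_mx /= mulmx1 scale1r.
  by rewrite halvesK ?sZ.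
- by move=> chi; rewrite /word_mx /letter_mx /= Z1 !(scaler0, trmx0, addr0)
    shear0 mulmx1.
Qed.

Definition weyl_word (P : mxkk -> 'M[R]_k) : word :=
  [:: (false, fun A => 2%:R^-1 *: P A); (true, fun A => 2%:R^-1 *: - invmx (P A));
      (false, fun A => 2%:R^-1 *: P A)].

Lemma weyl_word_mx chi (P : mxkk -> 'M[R]_k) A : (P A)^T = P A ->
  word_mx chi (weyl_word P) A = weyl chi (P A).
Proof.
move=> sP; rewrite /word_mx /letter_mx /= !halvesK // ?mulmx1 //.
by rewrite linearN /= trmx_inv sP.
Qed.

Lemma weyl_word_continuous (P : mxkk -> 'M[R]_k) :
  cont_near1 P -> P 1%:M \in unitmx ->
  \forall A \near (1%:M : mxkk), word_continuous_at A (weyl_word P).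
Proof.
move=> cP uP; have := cont_near1_scale 2%:R^-1 (cont_near1_opp
  (cont_near1_inv cP uP)).
have := cont_near1_scale 2%:R^-1 cP; rewrite /cont_near1.
by apply: near1S2 => A ? ? /=.
Qed.

(** By [weylMN] the word w(P1) w(-Q1) w(P2) w(-Q2) represents the product. At 1 it reads w(P1)
    w(-Q1) w(Q1) w(-P1) and cancels from the middle by [weylN]. A single ratio would cancel in this
    way only if its two matrices agreed at 1. *)
Lemma shearable_levi_ratio2 (P1 Q1 P2 Q2 : mxkk -> 'M[R]_k) :
  cont_near1 P1 -> cont_near1 Q1 -> cont_near1 P2 -> cont_near1 Q2 ->
  P1 1%:M \in unitmx -> Q1 1%:M \in unitmx ->
  P1 1%:M = Q2 1%:M -> Q1 1%:M = P2 1%:M ->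
  (forall A, (P1 A)^T = P1 A) -> (forall A, (Q1 A)^T = Q1 A) ->
  (forall A, (P2 A)^T = P2 A) -> (forall A, (Q2 A)^T = Q2 A) ->
  shearable (fun A => levi (P1 A *m invmx (Q1 A) *m (P2 A *m invmx (Q2 A)))).
Proof.
move=> cP1 cQ1 cP2 cQ2 uP1 uQ1 E1 E2 sP1 sQ1 sP2 sQ2.
have uQ2 : Q2 1%:M \in unitmx by rewrite -E1.
have uP2 : P2 1%:M \in unitmx by rewrite -E2.
pose N (Z : mxkk -> 'M[R]_k) A := - Z A.
have sN (Z : mxkk -> 'M[R]_k) A : (forall A, (Z A)^T = Z A) -> (N Z A)^T = N Z A.
  by move=> sZ; rewrite /N linearN /= sZ.
have uN (Z : mxkk -> 'M[R]_k) : Z 1%:M \in unitmx -> N Z 1%:M \in unitmx.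
  by move=> uZ; rewrite /N -scaleN1r unitmxZ ?unitrN1.
exists ((weyl_word P1 ++ weyl_word (N Q1)) ++ (weyl_word P2 ++ weyl_word (N Q2))).
have c1 := weyl_word_continuous cP1 uP1.
have c2 := weyl_word_continuous (cont_near1_opp cQ1) (uN _ uQ1).
have c3 := weyl_word_continuous cP2 uP2.
have c4 := weyl_word_continuous (cont_near1_opp cQ2) (uN _ uQ2).
split.
- apply: near1S2 (filterI c1 c2) (filterI c3 c4) => A [? ?] [? ?].
  by do !apply: word_continuous_at_cat.
- apply: near1S2 (filterI (cont_near1_unit cP1 uP1) (cont_near1_unit cQ1 uQ1))
    (filterI (cont_near1_unit cP2 uP2) (cont_near1_unit cQ2 uQ2)).
  move=> A [{}uP1 {}uQ1] [{}uP2 {}uQ2] _.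
  rewrite !word_mx_cat !weyl_word_mx ?sN // !weylMN //.
  by rewrite [RHS]leviM // unitmx_mul unitmx_inv ?uP1 ?uP2.
- move=> chi; rewrite !word_mx_cat !weyl_word_mx ?sN // /N -E1 -E2.
  rewrite mulmxA -(mulmxA (weyl _ _)).
  have := weylN chi (- Q1 1%:M); rewrite opprK => ->.
  by rewrite mulmx1 weylN.
Qed.

Lemma shearable_levi_col (j : 'I_k) (c : mxkk -> 'cV[R]_k) :
  cont_near1 c -> c 1%:M = 0 ->
  shearable (fun A => levi (1%:M + c A *m (delta_mx j ord0)^T)).
Proof.
move=> cc c1.
have cden : cont_near1 (fun A => col_den j (c A)).
  apply: cont_near1_add.
    apply: cont_near1_add; first exact: cont_near1_cst.
    apply: cont_near1_scale; apply: cont_near1_add; apply: cont_near1_mul => //;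
      [exact: cont_near1_cst|exact: cont_near1_cst|exact: cont_near1_tr].
  apply: cont_near1_opp; apply: near1S cc => A cA; apply: (cvg_scalemx (nbhs_filter A)).
    apply: (cvgM (F := nbhs A)); first exact: (@cvg_cst _ _ _ (nbhs A)).
    by move/(cvg_mxP (nbhs_filter A)) : cA; exact.
  exact: (@cvg_cst _ _ _ (nbhs A)).
have cnum : cont_near1 (fun A => col_num j (c A)).
  have ct : cont_near1 (fun A => 2%:R *: c A + delta_mx j ord0).
    by apply: cont_near1_add; [exact: cont_near1_scale|exact: cont_near1_cst].
  apply: cont_near1_add => //.
  by apply: cont_near1_mul => //; exact: cont_near1_tr.
have unum : col_num j (c 1%:M) \in unitmx.
  by rewrite c1 col_num0 unit_num_unit.
have uden : col_den j (c 1%:M) \in unitmx by rewrite c1 col_den0 unitmx1.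
(* At c = 0 the two ratios of [col_factor] are (1 + e_j e_j^T) 1^-1 and 1 (1 + e_j e_j^T)^-1, as the
   cancellation at 1 requires. *)
have H : shearable (fun A => levi (col_num j (c A) *m invmx (col_den j (c A))
    *m (1%:M *m invmx (unit_num R j)))).
  apply: (shearable_levi_ratio2 cnum cden (@cont_near1_cst _ _ 1%:M)
    (@cont_near1_cst _ _ (unit_num R j)) unum uden).
  - by rewrite c1 col_num0.
  - by rewrite c1 col_den0.
  - by move=> A; exact: col_num_sym.
  - by move=> A; exact: col_den_sym.
  - by move=> A; exact: trmx1.
  - by move=> A; exact: unit_num_sym.
apply: (shearable_eq H); apply: near1S (cont_near1_unit cden uden) => A uA _.
by rewrite -col_factor.
Qed.

Lemma shearable_levi (P : mxkk -> 'M[R]_k) : cont_near1 P -> P 1%:M = 1%:M ->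
  shearable (fun A => levi (P A)).
Proof.
move=> cP P1.
have cS n : cont_near1 (fun A => first_cols n (P A)).
  move: cP; rewrite /cont_near1; apply: near1S => A /(cvg_mxP (nbhs_filter A)) cA.
  apply/(cvg_mxP (nbhs_filter A)) => a b; rewrite mxE; under eq_fun do rewrite mxE.
  by case: ifP => _; [exact: cA|exact: (@cvg_cst _ _ _ (nbhs A))].
have uS n : first_cols n (P 1%:M) \in unitmx.
  by rewrite P1 first_cols1 unitmx1.
suff H n : (n <= k)%N -> shearable (fun A => levi (first_cols n (P A))).
  by apply: shearable_eq (H k (leqnn k)) _; apply: near1E => A _;
    rewrite first_cols_all.
elim: n => [_|n IH nk].
  exists [::]; split => //; apply: near1E => A //= _.
  by rewrite first_cols0 /levi invmx1 trmx1 -scalar_mx_block.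
pose j := Ordinal nk.
have cc : cont_near1 (fun A => col_coef j (P A)).
  apply: cont_near1_mul; first exact: cont_near1_inv.
  move: cP; rewrite /cont_near1; apply: near1S => A /(cvg_mxP (nbhs_filter A)) cA.
  apply/(cvg_mxP (nbhs_filter A)) => a b; rewrite !mxE; under eq_fun do rewrite !mxE.
  by apply: (cvgB (F := nbhs A)); [exact: cA|exact: (@cvg_cst _ _ _ (nbhs A))].
have c1 : col_coef j (P 1%:M) = 0 by rewrite P1 col_coef1.
apply: shearable_eq (shearable_mul (IH (ltnW nk)) (shearable_levi_col j cc c1)) _.
apply: near1S2 (cont_near1_unit (cS n) (uS n))
  (cont_near1_unit (cS n.+1) (uS n.+1)) => A uA uA' _.
rewrite (@first_colsS _ _ j) // leviM //.
(* [leviM] also needs the column factor to be invertible; this follows from invertibility of the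
   next matrix of first columns. *)
by move: uA'; rewrite (@first_colsS _ _ j) // unitmx_mul => /andP[].
Qed.

(** The block decomposition reduces the claim to two shears and a Levi factor. The shears are
    trivial at 1 because the off-diagonal blocks of 1 vanish. *)
Lemma shearable_id : shearable id.
Proof.
pose P (A : mxkk) := ulsubmx A.
have cP : cont_near1 P.
  rewrite /cont_near1; apply: near1E => A.
  apply/(cvg_mxP (nbhs_filter A)) => i j; rewrite !mxE.
  by under eq_fun do rewrite !mxE; exact: coord_continuous.
have cQ : cont_near1 (fun A : mxkk => ursubmx A).
  rewrite /cont_near1; apply: near1E => A.
  apply/(cvg_mxP (nbhs_filter A)) => i j; rewrite !mxE.
  by under eq_fun do rewrite !mxE; exact: coord_continuous.
have cR : cont_near1 (fun A : mxkk => dlsubmx A).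
  rewrite /cont_near1; apply: near1E => A.
  apply/(cvg_mxP (nbhs_filter A)) => i j; rewrite !mxE.
  by under eq_fun do rewrite !mxE; exact: coord_continuous.
have [P1 Q1 R1] : [/\ P 1%:M = 1%:M, ursubmx (1%:M : mxkk) = 0
    & dlsubmx (1%:M : mxkk) = 0].
  by rewrite /P [1%:M]scalar_mx_block block_mxKul block_mxKur block_mxKdl.
have uP : P 1%:M \in unitmx by rewrite P1 unitmx1.
have nP := cont_near1_unit cP uP.
have cV := cont_near1_inv cP uP.
apply: shearable_eq (shearable_mul
  (@shearable_shear true (fun A => dlsubmx A *m invmx (P A)) _ _ _)
  (shearable_mul (shearable_levi cP P1)
  (@shearable_shear false (fun A => invmx (P A) *m ursubmx A) _ _ _))) _.
- exact: cont_near1_mul.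
- by rewrite R1 mul0mx.
- by apply: near1S nP => A uA SA; case: (Sp_shear_decomposition SA uA).
- exact: cont_near1_mul.
- by rewrite Q1 mulmx0.
- by apply: near1S nP => A uA SA; case: (Sp_shear_decomposition SA uA).
- by apply: near1S nP => A uA SA; case: (Sp_shear_decomposition SA uA).
Qed.

End ShearWords.

(** * Nilpotent parts of shears and the elementary form they take *)

Section Nilpotents.
Variables (R : realType) (k : nat).
Implicit Types (Y Z : 'M[R]_k) (y z : 'cV[R]_k).

Definition shear_nil (b : bool) Z : 'M[R]_(k + k) :=
  if b then block_mx 0 0 Z 0 else block_mx 0 Z 0 0.

Lemma shear_nilE b Z : shear b Z = 1%:M + shear_nil b Z.
Proof.
by case: b; rewrite /shear /shear_nil [in RHS]scalar_mx_block add_block_mx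
  !(addr0, add0r).
Qed.

Lemma shear_nilM b Y Z : shear_nil b Y *m shear_nil b Z = 0.
Proof.
by case: b; rewrite /shear_nil mulmx_block !(mul0mx, mulmx0) !addr0 block_mx0.
Qed.

Lemma shear_nil0 b : shear_nil b 0 = 0.
Proof. by case: b; rewrite /shear_nil block_mx0. Qed.

Lemma cvg_shear_nil (T : Type) (F : set_system T) (FF : Filter F) b
    (f : T -> 'M[R]_k) Z :
  f @ F --> Z -> (fun t => shear_nil b (f t)) @ F --> shear_nil b Z.
Proof.
by move=> fZ; case: b; apply: cvg_block_mx => //; exact: cvg_cst.
Qed.

Definition lagr_inj (b : bool) z : 'cV[R]_(k + k) :=
  if b then col_mx 0 z else col_mx z 0.

Definition sym_outer y z : 'M[R]_k := y *m z^T + z *m y^T.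

Lemma sym_outer0 y : sym_outer y 0 = 0.
Proof. by rewrite /sym_outer trmx0 mulmx0 mul0mx addr0. Qed.

(** This is the shape u + omega(u, v) w + omega(u, w) v required of a factor that respects the
    splitting. The sign compensates for J: pairing p with a vector of the second summand gives plus,
    with one of the first summand minus, a product of coordinates. *)
Lemma shear_nil_outer b y z (p : 'cV[R]_(k + k)) :
  shear_nil b (sym_outer y z) *m p =
  std_omega p (lagr_inj b y) *: lagr_inj b ((-1 : R) ^+ (~~ b) *: z)
  + std_omega p (lagr_inj b ((-1 : R) ^+ (~~ b) *: z)) *: lagr_inj b y.
Proof.
have sc (u v w : 'cV[R]_k) : u *m v^T *m w = (w^T *m v) ord0 ord0 *: u.
  rewrite -mulmxA [v^T *m w]mx11_scalar mul_mx_scalar; congr (_ *: _).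
  by rewrite -[v^T *m w]trmxK trmx_mul trmxK [LHS]mxE.
rewrite -[p]vsubmxK; set p1 := usubmx p; set p2 := dsubmx p.
rewrite /std_omega /std_J /lagr_inj /shear_nil tr_col_mx !mul_row_block.
rewrite !(mul0mx, mulmx0, mulmx1, add0r, addr0, mulmxN).
case: b => /=.
  rewrite expr0 scale1r mul_block_col !(mul0mx, mulmx0, addr0, add0r).
  rewrite !mul_row_col !(mul0mx, mulmx0, addr0, add0r) !scale_col_mx.
  by rewrite add_col_mx !scaler0 addr0 /sym_outer mulmxDl !sc addrC.
rewrite expr1 scaleN1r mul_block_col !(mul0mx, mulmx0, addr0, add0r).
rewrite !mul_row_col !(mul0mx, mulmx0, addr0, add0r) !scale_col_mx.
rewrite add_col_mx !scaler0 addr0 /sym_outer mulmxDl !sc addrC.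
by rewrite !mulNmx mulmxN opprK [X in X *: - z]mxE scaleNr scalerN opprK.
Qed.

End Nilpotents.

(** * Endomorphisms of the bundle supported in one trivialization *)

Lemma cvg_pair2 (T : Type) (F : set_system T) (FF : Filter F)
    (U W : topologicalType) (f : T -> U) (g : T -> W) (a : U) (b : W) :
  f @ F --> a -> g @ F --> b -> (fun t => (f t, g t)) @ F --> (a, b).
Proof. by move=> fa gb; exact: cvg_pair. Qed.

Lemma open_setXT (U W : topologicalType) (A : set U) :
  open A -> open (A `*` [set: W]).
Proof.
move=> oA; have -> : A `*` [set: W] = fst @^-1` A.
  by apply/seteqP; split=> [p []|p] //=.
by apply: open_comp => // p _; exact: cvg_fst.
Qed.

Section ChartEndomorphisms.
Variables (R : realType) (k : nat) (X : topologicalType).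
Variable V : sp_bundle R k X.
Variable i : triv_idx V.

Lemma trivK x : dom i x -> cancel (triv i x) (triv i x)^-1%VF.
Proof.
by have [_ /(_ x) H _ _] := triv_local i => /H [ki _] v; apply: lker0_lfunK; rewrite ki.
Qed.

Lemma trivVK x : dom i x -> cancel (triv i x)^-1%VF (triv i x).
Proof.
have [_ /(_ x) H _ _] := triv_local i => /H [_ li] v.
by apply: limg_lfunVK; rewrite li memvf.
Qed.

(* The endomorphism with matrix 1 + N x in the chart i; N is meant to vanish
   outside the domain of the chart, where triv i is junk. *)
Definition chart_end (N : X -> 'M[R]_(k + k)) : vb_end V := fun x =>
  \1%VF + ((triv i x)^-1%VF \o (linfun (mulmx (N x)) \o triv i x))%VF.

Lemma chart_endE N x v :
  chart_end N x v = v + (triv i x)^-1%VF (N x *m triv i x v).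
Proof. by rewrite add_lfunE id_lfunE !comp_lfunE lfunE. Qed.

Lemma chart_end_id N x : N x = 0 -> chart_end N x = \1%VF.
Proof.
by move=> N0; apply/lfunP => v; rewrite chart_endE N0 mul0mx linear0 addr0
  id_lfunE.
Qed.

Lemma triv_chart_end N x v : dom i x ->
  triv i x (chart_end N x v) = (1%:M + N x) *m triv i x v.
Proof.
by move=> ix; rewrite chart_endE linearD /= trivVK // mulmxDl mul1mx.
Qed.

Lemma chart_end_comp N M x : (~ dom i x -> N x = 0 /\ M x = 0) ->
  (chart_end N x \o chart_end M x)%VF =
  chart_end (fun x => (1%:M + N x) *m (1%:M + M x) - 1%:M) x.
Proof.
move=> NM; have [ix|/NM [N0 M0]] := pselect (dom i x).
  apply/lfunP => v; apply: (can_inj (trivK ix)).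
  by rewrite comp_lfunE !triv_chart_end // mulmxA [1%:M + (_ - _)]addrC subrK.
by rewrite !chart_end_id ?N0 ?M0 ?addr0 ?mulmx1 ?subrr // comp_lfun1l.
Qed.

(** The set C is closed in all of X, not just in U, so an extension by 0 is continuous at the
    boundary of U too. *)
Definition supported_in (U : set X) (W : nmodType) (f : X -> W) :=
  exists C, [/\ closed C, C `<=` U & forall x, ~ C x -> f x = 0].

Lemma supported_in_out U (W : nmodType) (f : X -> W) x :
  supported_in U f -> ~ U x -> f x = 0.
Proof. by move=> [C [_ CU f0]] Ux; apply: f0 => /CU. Qed.

Lemma dom_open : open (dom i).
Proof. by case: (triv_local i). Qed.

Lemma triv_vec_cvg (e : Defs.total V) : dom i (Defs.proj e) ->
  (fun e' : Defs.total V => triv i (Defs.proj e') (vec e')) @ e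
    --> triv i (Defs.proj e) (vec e).
Proof.
move=> ie; have [_ _ + _] := triv_local i.
have oP : open (@Defs.proj R X V @^-1` dom i).
  by apply: open_comp; [move=> x _; exact: Defs.proj_continuous|exact: dom_open].
rewrite (continuous_open_subspace _ oP) => /(_ e); rewrite inE => /(_ ie) c.
exact: (cvg_comp _ _ c cvg_snd).
Qed.

(** The total space is covered by two open sets: over the chart the map is conjugate to (x, p) |->
    (x, (1 + N x) p), and over the complement of the closed support it is the identity. *)
Lemma chart_end_continuous (N : X -> 'M[R]_(k + k)) : supported_in (dom i) N ->
  (forall x, dom i x -> N @ x --> N x) -> continuous (total_map (chart_end N)).
Proof.
move=> [C [cC CU N0]] cN e.
have [ie|ie] := pselect (dom i (Defs.proj e)).
  have oP : open (@Defs.proj R X V @^-1` dom i).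
    by apply: open_comp; [move=> x _; exact: Defs.proj_continuous|exact: dom_open].
  pose h (e' : Defs.total V) : X * 'cV[R]_(k + k) :=
    (Defs.proj e', (1%:M + N (Defs.proj e')) *m triv i (Defs.proj e') (vec e')).
  pose g (p : X * 'cV[R]_(k + k)) : Defs.total V := pt ((triv i p.1)^-1%VF p.2).
  have hg : {near e, g \o h =1 total_map (chart_end N)}.
    have : nbhs e (@Defs.proj R X V @^-1` dom i) by exact: open_nbhs_nbhs.
    apply: filterS => e' ie'; rewrite /g /h /total_map /=.
    by rewrite -triv_chart_end // trivK.
  have hge : total_map (chart_end N) e = g (h e).
    by rewrite /g /h /total_map /= -triv_chart_end // trivK.
  rewrite /continuous_at hge; apply: (cvg_trans (near_eq_cvg hg)).
  have hc : h @ e --> h e.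
    apply: (cvg_pair2 (nbhs_filter e)); first exact: Defs.proj_continuous.
    apply: (cvg_mulmx (nbhs_filter e)); last exact: triv_vec_cvg.
    apply: (cvg_addmx (nbhs_filter e)); first exact: cvg_cst.
    apply: (@cvg_comp _ _ _ (@Defs.proj R X V) N _ (nbhs (Defs.proj e))).
      exact: Defs.proj_continuous.
    exact: cN.
  apply: (cvg_comp _ _ hc).
  have [_ _ _] := triv_local i.
  have oU : open (dom i `*` [set: 'cV[R]_(k + k)]).
    exact: open_setXT dom_open.
  by rewrite (continuous_open_subspace _ oU) => /(_ (h e)); rewrite inE; apply.
have oC : open (@Defs.proj R X V @^-1` (~` C)).
  by apply: open_comp; [move=> x _; exact: Defs.proj_continuous|exact: closed_openC].
have E : {near e, id =1 total_map (chart_end N)}.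
  have : nbhs e (@Defs.proj R X V @^-1` (~` C)).
    by apply: open_nbhs_nbhs; split => // /CU.
  apply: filterS => -[x v] Cx; rewrite /total_map chart_end_id ?id_lfunE //.
  exact: N0.
have Ee : total_map (chart_end N) e = e.
  rewrite /total_map chart_end_id ?id_lfunE; first by case: (e).
  by apply: N0 => /CU.
rewrite /continuous_at Ee; exact: (cvg_trans (near_eq_cvg E)).
Qed.

End ChartEndomorphisms.

(** * From words in shears to compositions of elementary automorphisms *)

Section Factorization.
Variables (R : realType) (k : nat) (X : topologicalType).
Variable V : sp_bundle R k X.

(** The Lagrangian clause is conditional so that one factorization serves both halves of the
    theorem. *)
Definition good_factor (E : vb_end V) : Prop :=
  [/\ symplectic_automorphism E, unipotent E, elementary E
    & lagrangian V -> respects_splitting E].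

Definition factored (T : vb_end V) : Prop := exists (N : nat) (E : nat -> vb_end V),
  (forall x, T x = vb_comp E N x) /\ (forall j, (j < N)%N -> good_factor (E j)).

Lemma factored_ext (T T' : vb_end V) : (forall x, T x = T' x) -> factored T ->
  factored T'.
Proof. by move=> TT' [N [E [TE gE]]]; exists N, E; split=> // x; rewrite -TT'. Qed.

Lemma factored_id (T : vb_end V) : (forall x, T x = \1%VF) -> factored T.
Proof. by move=> T1; exists 0%N, (fun=> T); split. Qed.

Lemma eq_vb_comp (E F : nat -> vb_end V) n x :
  (forall j, (j < n)%N -> E j x = F j x) -> vb_comp E n x = vb_comp F n x.
Proof.
elim: n => //= n IH EF; rewrite EF // IH // => j jn.
by apply: EF; rewrite ltnS ltnW.
Qed.

Lemma factored_comp (E T : vb_end V) : good_factor E -> factored T ->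
  factored (fun x => (E x \o T x)%VF).
Proof.
move=> gE [N [F [TF gF]]].
exists N.+1, (fun j => if (j < N)%N then F j else E); split=> [x|j _].
  rewrite /= ltnn TF; congr (_ \o _)%VF.
  by apply: eq_vb_comp => j ->.
by case: ifP => // jN; exact: gF.
Qed.

Variable i : triv_idx V.

Definition outer_factor (b : bool) (y z : X -> 'cV[R]_k) : vb_end V :=
  chart_end i (fun x => shear_nil b (sym_outer (y x) (z x))).

(** In the chart this is [shear_nil_outer]; elsewhere v = w = 0 will do. Membership in [lagr_sub] is
    conditional because that set is defined by another chart, and only block diagonal transitions
    carry it over. *)
Lemma outer_factorE (b : bool) (y z : X -> 'cV[R]_k) :
  (forall x, ~ dom i x -> z x = 0) ->
  forall x, exists v w : fib V x,
    [/\ lagrangian V -> lagr_sub b v, lagrangian V -> lagr_sub b w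
      & forall u, outer_factor b y z x u = u + omega u v *: w + omega u w *: v].
Proof.
move=> z0 x; have [ix|/z0 zx0] := pselect (dom i x); last first.
  exists 0, 0; split.
  - by move=> _; rewrite /lagr_sub /= linear0; case: b; rewrite linear0.
  - by move=> _; rewrite /lagr_sub /= linear0; case: b; rewrite linear0.
  - move=> u; rewrite /outer_factor chart_end_id ?id_lfunE ?scaler0 ?addr0 //.
    by rewrite zx0 sym_outer0 shear_nil0.
exists ((triv i x)^-1%VF (lagr_inj b (y x))).
exists ((triv i x)^-1%VF (lagr_inj b ((-1 : R) ^+ (~~ b) *: z x))).
have L q : lagrangian V -> lagr_sub b ((triv i x)^-1%VF (lagr_inj b q)).
  move=> LV; apply/(lagr_subE _ _ LV ix); rewrite trivVK // /lagr_inj.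
  by case: (b); rewrite ?col_mxKu ?col_mxKd.
split=> [LV|LV|u]; [exact: L|exact: L|].
rewrite /outer_factor chart_endE shear_nil_outer linearD !linearZ /= addrA.
by rewrite !(omegaE _ _ ix) !trivVK.
Qed.

Lemma chart_end_symplectic (N : X -> 'M[R]_(k + k)) :
  (forall x, ~ dom i x -> N x = 0) ->
  (forall x, Sp (1%:M + N x)) -> symplectic (chart_end i N).
Proof.
move=> N0 SN x u v; have [ix|/N0 Nx] := pselect (dom i x); last first.
  by rewrite chart_end_id // !id_lfunE.
rewrite !(omegaE _ _ ix) !triv_chart_end // /std_omega trmx_mul.
by have := SN x; rewrite /Sp /= => SNx; rewrite -[in RHS]SNx !mulmxA.
Qed.

(** As N^2 = 0, the inverse of 1 + N is 1 - N, which is continuous for the same reason as 1 + N. The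
    rank bound holds because E u - u lies in the span of v and w. *)
Lemma outer_factor_good (b : bool) (y z : X -> 'cV[R]_k) :
  supported_in (dom i) z ->
  (forall x, dom i x -> y @ x --> y x) -> (forall x, dom i x -> z @ x --> z x) ->
  good_factor (outer_factor b y z).
Proof.
move=> sz cy cz; pose N x := shear_nil b (sym_outer (y x) (z x)).
have z0 x : ~ dom i x -> z x = 0 by exact: supported_in_out.
have Nz x : z x = 0 -> N x = 0.
  by move=> zx0; rewrite /N zx0 sym_outer0 shear_nil0.
have N0 x : ~ dom i x -> N x = 0 by move/z0; exact: Nz.
have sN : supported_in (dom i) N.
  by have [C [cC CU C0]] := sz; exists C; split=> // x /C0; exact: Nz.
have sNN : supported_in (dom i) (fun x => - N x).
  by have [C [cC CU C0]] := sN; exists C; split=> // x /C0 ->; rewrite oppr0.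
have cN x : dom i x -> N @ x --> N x.
  move=> ix; apply: (cvg_shear_nil (nbhs_filter x)).
  apply: (cvg_addmx (nbhs_filter x)); apply: (cvg_mulmx (nbhs_filter x));
    by [exact: cy|exact: cz|apply: (cvg_trmx (nbhs_filter x)); exact: cy
       |apply: (cvg_trmx (nbhs_filter x)); exact: cz].
have NN x : N x *m N x = 0 by rewrite shear_nilM.
have inv (M M' : X -> 'M[R]_(k + k)) :
    (forall x, ~ dom i x -> M x = 0 /\ M' x = 0) ->
    (forall x, (1%:M + M x) *m (1%:M + M' x) = 1%:M) ->
    cancel (total_map (chart_end i M')) (total_map (chart_end i M)).
  move=> M0 MM [x v]; rewrite /total_map /pt /=; congr existT.
  have := chart_end_comp (i := i) (N := M) (M := M') (M0 x).
  rewrite [RHS]chart_end_id ?MM ?subrr // => /lfunP /(_ v).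
  by rewrite comp_lfunE id_lfunE.
have Nout x : ~ dom i x -> N x = 0 /\ - N x = 0.
  by move=> /N0 ->; rewrite oppr0.
have Nout' x : ~ dom i x -> - N x = 0 /\ N x = 0.
  by move=> /N0 ->; rewrite oppr0.
have N2 x : (chart_end i N x - \1 =
    (triv i x)^-1 \o (linfun (mulmx (N x)) \o triv i x))%VF.
  by rewrite /chart_end addrC addKr.
have sq x v : (chart_end i N x - \1)%VF ((chart_end i N x - \1)%VF v) = 0.
  have [ix|/N0 Nx] := pselect (dom i x); last first.
    by rewrite chart_end_id // subrr lfunE.
  rewrite N2 !comp_lfunE !lfunE /= trivVK // mulmxA NN mul0mx.
  exact: linear0.
split.
- split.
    split; first exact: chart_end_continuous.
    exists (total_map (chart_end i (fun x => - N x))); split.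
    + apply: chart_end_continuous => // x ix.
      by apply: (cvg_oppmx (nbhs_filter x)); exact: cN.
    + apply: inv => // x; rewrite mulmxDl mul1mx mulmxDr mulmx1 mulNmx NN.
      by rewrite oppr0 addr0 addrK.
    + apply: inv => // x; rewrite mulmxDl mul1mx mulmxDr mulmx1 mulmxN NN.
      by rewrite oppr0 addr0 subrK.
  apply: chart_end_symplectic => // x; rewrite -shear_nilE; apply: shear_Sp.
  by rewrite /sym_outer linearD /= !trmx_mul !trmxK addrC.
- by move=> x; exists 2%N => v; exact: sq.
- move=> x; split.
    by apply/lfunP => v; rewrite comp_lfunE sq lfunE.
  have [v [w [_ _ E]]] := outer_factorE b y z0 x.
  have : (limg (outer_factor b y z x - \1)%VF <= <[v]> + <[w]>)%VS.
    apply/subvP => _ /memv_imgP [u _ ->].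
    rewrite add_lfunE opp_lfunE id_lfunE E.
    rewrite addrAC (addrAC u) subrr add0r addrC.
    by apply: memv_add; rewrite memvZ // memv_line.
  move/dimvS => le1.
  have := leq_trans le1 (dimv_add_leqif <[v]> <[w]>).
  by rewrite !dim_vline; case: (v != 0); case: (w != 0) => /=;
    case: (\dim _) => [|[|[|d]]].
- move=> LV; exists b => x; have [v [w [lv lw E]]] := outer_factorE b y z0 x.
  by exists v, w; split; [exact: lv|exact: lw|exact: E].
Qed.

(** Y is the sum of the matrices e_a (row a of Y), so Y + Y^T is a sum of k terms of the form
    [sym_outer], continuous in x without any diagonalization. Shears of the same type multiply by
    adding their matrices. *)
Lemma factored_shear (b : bool) (Y : X -> 'M[R]_k) (T : vb_end V) :
  supported_in (dom i) Y -> (forall x, dom i x -> Y @ x --> Y x) -> factored T ->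
  factored (fun x =>
    (chart_end i (fun x => shear_nil b (Y x + (Y x)^T)) x \o T x)%VF).
Proof.
move=> sY cY fT.
pose M (a : 'I_k) x := delta_mx a ord0 *m row a (Y x) : 'M[R]_k.
have ME x : Y x = \sum_a M a x.
  apply/matrixP => a c; rewrite summxE (bigD1 a) //= big1 ?addr0.
    by rewrite mxE big_ord1 !mxE !eqxx mul1r.
  by move=> j /negPf ja; rewrite mxE big_ord1 !mxE eq_sym ja mul0r.
pose S (r : seq 'I_k) x := \sum_(a <- r) M a x.
have Y0 x : ~ dom i x -> Y x = 0 by exact: supported_in_out.
have M0 a x : Y x = 0 -> M a x = 0.
  by move=> Yx0; rewrite /M Yx0 row0 mulmx0.
suff H r : factored (fun x =>
    (chart_end i (fun x => shear_nil b (S r x + (S r x)^T)) x \o T x)%VF).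
  apply: factored_ext (H (index_enum 'I_k)) => x; congr (_ \o _)%VF.
  by rewrite /chart_end ME.
elim: r => [|a r IH].
  apply: factored_ext fT => x.
  rewrite chart_end_id ?comp_lfun1l //.
  by rewrite /S big_nil trmx0 addr0 shear_nil0.
have gE : good_factor (outer_factor b (fun=> delta_mx a ord0)
    (fun x => (row a (Y x))^T)).
  apply: outer_factor_good.
  - have [C [cC CU C0]] := sY; exists C; split=> // x /C0 ->.
    by rewrite row0 trmx0.
  - by move=> x _; exact: cvg_cst.
  - move=> x ix; apply: (cvg_trmx (nbhs_filter x)).
    apply/(cvg_mxP (nbhs_filter x)) => c d; rewrite mxE.
    under eq_fun do rewrite mxE.
    by move: c d; have /(cvg_mxP (nbhs_filter x)) := cY x ix => H c d; exact: H.
apply: factored_ext (factored_comp gE IH) => x.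
rewrite comp_lfunA; congr (_ \o _)%VF; rewrite /outer_factor chart_end_comp.
  rewrite /chart_end; congr (_ + (_ \o (linfun (mulmx _) \o _)))%VF.
  rewrite -!shear_nilE -shearD shear_nilE addrC addKr; congr shear_nil.
  by rewrite /S big_cons linearD /= addrACA /sym_outer trmxK trmx_mul.
move=> /Y0 Yx; rewrite Yx row0 trmx0 sym_outer0 shear_nil0; split=> //.
by rewrite /S big1 ?trmx0 ?addr0 ?shear_nil0 // => c _; exact: M0.
Qed.

(** Induction on the letters. Each letter carries the cutoff, hence is supported in the chart,
    although A need not be meaningful outside it. *)
Lemma factored_word (s : word R k) (A : X -> 'M[R]_(k + k)) (chi : X -> R)
    (T : vb_end V) :
  supported_in (dom i) chi -> (forall x, dom i x -> chi @ x --> chi x) ->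
  (forall x, dom i x -> A @ x --> A x) ->
  (forall x, dom i x -> word_continuous_at (A x) s) ->
  factored T ->
  factored (fun x =>
    (chart_end i (fun x => word_mx (chi x) s (A x) - 1%:M) x \o T x)%VF).
Proof.
move=> schi cchi cA cs fT; have chi0 := supported_in_out schi.
have w0 s' x : chi x = 0 -> word_mx (chi x) s' (A x) = 1%:M.
  move=> ->; elim: s' => //= l s' ->.
  by rewrite /letter_mx scale0r shear0 mulmx1.
elim: s cs => [_|l s IH cs].
  apply: factored_ext fT => x.
  by rewrite chart_end_id ?comp_lfun1l // /word_mx /= subrr.
have {}IH := IH (fun x ix => proj2 (cs x ix)).
pose Y x := chi x *: l.2 (A x).
have sY : supported_in (dom i) Y.
  by have [C [cC CU C0]] := schi; exists C; split=> // x /C0; rewrite /Y => ->;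
    rewrite scale0r.
have cY x : dom i x -> Y @ x --> Y x.
  move=> ix; apply: (cvg_scalemx (nbhs_filter x)); first exact: cchi.
  apply: (@cvg_comp _ _ _ A l.2 _ (nbhs (A x))); first exact: cA.
  exact: (proj1 (cs x ix)).
apply: factored_ext (factored_shear l.1 sY cY IH) => x.
rewrite comp_lfunA; congr (_ \o _)%VF; rewrite chart_end_comp.
  rewrite /chart_end; congr (_ + (_ \o (linfun (mulmx _) \o _)))%VF.
  rewrite -shear_nilE [1%:M + _]addrC subrK /=; congr (_ *m _ - _).
  by rewrite /letter_mx /Y linearZ /= -scalerDr.
move=> ix; rewrite w0 ?chi0 // subrr; split=> //.
by rewrite /Y chi0 // scale0r trmx0 addr0 shear_nil0.
Qed.

End Factorization.

(** * Retraction of the real line onto the unit interval *)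

Section UnitInterval.
Variable R : realType.

Definition clamp (t : R) : R := Num.max 0 (Num.min 1 t).

Lemma clamp_ge0 t : 0 <= clamp t.
Proof. by rewrite /clamp le_max lexx. Qed.

Lemma clamp_le1 t : clamp t <= 1.
Proof. by rewrite /clamp ge_max ler01 ge_min lexx. Qed.

Lemma clamp_id t : 0 <= t <= 1 -> clamp t = t.
Proof. by move=> /andP[t0 t1]; rewrite /clamp min_r ?max_r. Qed.

Lemma clamp_neq0 t : clamp t != 0 -> 0 < t.
Proof.
by move=> h; rewrite ltNge; apply: contra h => t0; rewrite /clamp min_r ?max_l
  ?(le_trans t0).
Qed.

Lemma clamp_eq1 t : 1 <= t -> clamp t = 1.
Proof. by move=> t1; rewrite /clamp min_l ?max_r. Qed.

Lemma clamp_continuous : continuous clamp.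
Proof.
move=> t; apply: (@continuous_max R R (fun=> 0) (fun t => Num.min 1 t)).
  exact: cvg_cst.
by apply: (@continuous_min R R (fun=> 1) id); [exact: cvg_cst|exact: cvg_id].
Qed.

End UnitInterval.

(** * The homotopy read in a trivialization *)

Section Homotopy.
Variables (R : realType) (k : nat) (X : topologicalType).
Variables (V : sp_bundle R k X) (H : R -> vb_end V).
Hypothesis H_symplectic : forall t : R, 0 <= t <= 1 -> symplectic (H t).
Hypothesis H_continuous :
  {within [set p : R * Defs.total V | 0 <= p.1 <= 1],
    continuous (fun p : R * Defs.total V => total_map (H p.1) p.2)}.

(** Clamping the time extends the homotopy to all real times and replaces continuity on a subspace
    by plain continuity. *)
Lemma clamp_homotopy_continuous :
  continuous (fun p : R * Defs.total V => total_map (H (clamp p.1)) p.2).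
Proof.
move=> p.
pose c (p : R * Defs.total V) := (clamp p.1, p.2).
have c01 q : [set p : R * Defs.total V | 0 <= p.1 <= 1] (c q).
  by rewrite /c /= clamp_ge0 clamp_le1.
have cc : c @ p --> c p.
  apply: (cvg_pair2 (nbhs_filter p)); last exact: cvg_snd.
  apply: (@cvg_comp _ _ _ fst (@clamp R) _ (nbhs p.1)); first exact: cvg_fst.
  exact: clamp_continuous.
move/subspace_continuousP : H_continuous => /(_ (c p) (c01 p)) Hc.
apply: (@cvg_comp _ _ _ c _ _ (within _ (nbhs (c p))) _ _ Hc).
move=> A nA; have : nbhs p [set q | 0 <= (c q).1 <= 1 -> A (c q)] := cc _ nA.
by apply: filterS => q /(_ (c01 q)).
Qed.

Variable i : triv_idx V.

Definition homotopy_mx (t : R) (x : X) : 'M[R]_(k + k) :=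
  \matrix_(a, b) (triv i x (H (clamp t) x ((triv i x)^-1%VF (delta_mx b ord0))))
    a ord0.

Lemma triv_homotopy t x v : dom i x ->
  triv i x (H (clamp t) x v) = homotopy_mx t x *m triv i x v.
Proof.
move=> ix; rewrite -{1}[v](trivK ix); set p := triv i x v.
have pE : p = \sum_b p b ord0 *: delta_mx b ord0.
  by rewrite {1}[p]matrix_sum_delta; apply: eq_bigr => b _; rewrite big_ord1.
apply/colP => a; rewrite {1}pE !linear_sum summxE mxE; apply: eq_bigr => b _.
by rewrite !linearZ !mxE mulrC; congr (_ * _).
Qed.

Lemma std_omega_delta (A : 'M[R]_(k + k)) a b :
  std_omega (A *m delta_mx a ord0) (A *m delta_mx b ord0)
  = (A^T *m std_J R k *m A) a b.
Proof.
rewrite /std_omega trmx_mul trmx_delta !mulmxA -colE -!mulmxA -rowE !mxE.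
by apply: eq_bigr => j _; rewrite !mxE.
Qed.

Lemma homotopy_mx_Sp t x : dom i x -> Sp (homotopy_mx t x).
Proof.
move=> ix; apply/matrixP => a b.
rewrite -std_omega_delta -[in LHS](trivVK ix (delta_mx a ord0)).
rewrite -[in LHS](trivVK ix (delta_mx b ord0)) -!triv_homotopy //.
rewrite -(omegaE _ _ ix) H_symplectic ?clamp_ge0 ?clamp_le1 // (omegaE _ _ ix).
rewrite !trivVK // -[delta_mx a _]mul1mx -[delta_mx b _]mul1mx std_omega_delta.
by rewrite trmx1 mul1mx mulmx1.
Qed.

Lemma homotopy_mx_continuous t x : dom i x ->
  (fun p : X * R => homotopy_mx p.2 p.1) @ (x, t) --> homotopy_mx t x.
Proof.
move=> ix; pose F := nbhs (x, t).
have FF : Filter F := nbhs_filter (x, t).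
apply/(cvg_mxP FF) => a b; rewrite mxE; under eq_fun do rewrite mxE.
pose w (y : X) : Defs.total V := pt ((triv i y)^-1%VF (delta_mx b ord0)).
have cw : w @ x --> w x.
  pose h (y : X) : X * 'cV[R]_(k + k) := (y, delta_mx b ord0).
  have ch : h @ x --> h x.
    by apply: (cvg_pair2 (nbhs_filter x)); [exact: cvg_id|exact: cvg_cst].
  have [_ _ _] := triv_local i.
  rewrite (continuous_open_subspace _ (open_setXT (dom_open i))).
  move=> /(_ (h x)); rewrite inE => /(_ (conj ix I)) cg.
  exact: (cvg_comp _ _ ch cg).
pose e (p : X * R) : Defs.total V := total_map (H (clamp p.2)) (w p.1).
have ce : e @ F --> e (x, t).
  have c : (fun p : X * R => (p.2, w p.1)) @ F --> (t, w x).
    apply: (cvg_pair2 FF); first exact: cvg_snd.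
    by apply: (cvg_comp _ _ _ cw); exact: cvg_fst.
  exact: (cvg_comp _ _ c (@clamp_homotopy_continuous (t, w x))).
have := cvg_comp _ _ ce (@triv_vec_cvg _ _ _ _ i (e (x, t)) ix).
by move/(cvg_mxP FF); exact.
Qed.

(** For e = 0 the quotient is 1, and it is jointly continuous in t, y and e. Compactness of [0, 1],
    in its near-covering form, makes the neighbourhood of (x, 0) independent of t. *)
Lemma homotopy_mx_near (G : set 'M[R]_(k + k)) x : dom i x ->
  nbhs (1%:M : 'M[R]_(k + k)) G ->
  \forall y \near x & e \near (0 : R), forall t : R, 0 <= t <= 1 ->
    dom i y /\ G (homotopy_mx t y *m invmx (homotopy_mx (t + e) y)).
Proof.
move=> ix G1.
pose P (p : X * R) (t : R) :=
  dom i p.1 /\ G (homotopy_mx t p.1 *m invmx (homotopy_mx (t + p.2) p.1)).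
have /compact_near_coveringP/(_ _ (nbhs (x, 0 : R)) P (nbhs_filter _)) :=
  @segment_compact R 0 1.
have near_t (t : R) : `[0, 1]%classic t ->
      \forall t' \near t & p \near (x, 0 : R), P p t'.
  move=> _; pose F := nbhs (t, (x, 0 : R)); have FF : Filter F := nbhs_filter _.
  have c1 : (fun q : R * (X * R) => homotopy_mx q.1 q.2.1) @ F --> homotopy_mx t x.
    have c : (fun q : R * (X * R) => (q.2.1, q.1)) @ F --> (x, t).
      apply: (cvg_pair2 FF); last exact: cvg_fst.
      by apply: (cvg_comp _ _ (@cvg_snd _ _ _ _ _) (@cvg_fst _ _ _ _ _)).
    exact: (cvg_comp _ _ c (homotopy_mx_continuous ix)).
  have c2 : (fun q : R * (X * R) => homotopy_mx (q.1 + q.2.2) q.2.1) @ F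
      --> homotopy_mx t x.
    have c : (fun q : R * (X * R) => (q.2.1, q.1 + q.2.2)) @ F --> (x, t).
      apply: (cvg_pair2 FF).
        by apply: (cvg_comp _ _ (@cvg_snd _ _ _ _ _) (@cvg_fst _ _ _ _ _)).
      have cD : (fun q : R * (X * R) => q.1 + q.2.2) @ F --> t + 0.
        apply: cvgD; first exact: cvg_fst.
        by apply: (cvg_comp _ _ (@cvg_snd _ _ _ _ _) (@cvg_snd _ _ _ _ _)).
      by rewrite addr0 in cD.
    exact: (cvg_comp _ _ c (homotopy_mx_continuous ix)).
  have uB := Sp_unitmx (homotopy_mx_Sp t ix).
  have c3 := cvg_mulmx FF c1 (cvg_invmx FF c2 uB).
  rewrite mulmxV // in c3.
  have nG : F [set q | G (homotopy_mx q.1 q.2.1 *m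
      invmx (homotopy_mx (q.1 + q.2.2) q.2.1))] by exact: c3.
  have nD : F [set q | dom i q.2.1].
    have c : (fun q : R * (X * R) => q.2.1) @ F --> x.
      by apply: (cvg_comp _ _ (@cvg_snd _ _ _ _ _) (@cvg_fst _ _ _ _ _)).
    by apply: c; apply: open_nbhs_nbhs; split => //; exact: dom_open.
  by apply: filterS2 nG nD => q qG qD; split.
move=> /(_ near_t); apply: filterS => -[y e] /= h t t01.
by apply: h; rewrite /= in_itv.
Qed.

End Homotopy.

(** * Fragmentation of the homotopy over a compact base *)

Section Fragmentation.
Variables (R : realType) (k : nat) (X : topologicalType).
Variables (V : sp_bundle R k X) (H : R -> vb_end V).
Hypothesis H_symplectic : forall t : R, 0 <= t <= 1 -> symplectic (H t).
Hypothesis H_continuous :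
  {within [set p : R * Defs.total V | 0 <= p.1 <= 1],
    continuous (fun p : R * Defs.total V => total_map (H p.1) p.2)}.

Definition stopped (tau : X -> R) : vb_end V := fun x => H (clamp (tau x)) x.

(** The word is evaluated at A = H_tau H_sigma^-1. Where sigma and tau differ, the cutoff is 1 and
    the word gives A; elsewhere in the chart A = 1 and the word gives 1 whatever the cutoff; outside
    the chart the cutoff is 0. *)
Lemma stopped_chart_step (i : triv_idx V) (s : word R k) (sigma tau chi : X -> R) :
  (forall c, word_mx c s 1%:M = 1%:M) -> word_continuous_at 1%:M s ->
  continuous sigma -> continuous tau -> continuous chi ->
  supported_in (dom i) chi ->
  (forall x, sigma x != tau x -> chi x = 1) ->
  (forall x, sigma x != tau x ->
    let A := homotopy_mx H i (tau x) x *m invmx (homotopy_mx H i (sigma x) x) in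
    word_continuous_at A s /\ (Sp A -> word_mx 1 s A = A)) ->
  factored (stopped sigma) -> factored (stopped tau).
Proof.
move=> s1 cs1 csigma ctau cchi schi chi1 wA.
pose B := homotopy_mx H i.
pose A x := B (tau x) x *m invmx (B (sigma x) x).
have SB t x : dom i x -> Sp (B t x) by exact: homotopy_mx_Sp.
have A1 x : dom i x -> sigma x = tau x -> A x = 1%:M.
  by move=> ix E; rewrite /A E mulmxV // Sp_unitmx //; exact: SB.
have cB (f : X -> R) x : continuous f -> dom i x ->
    (fun y => B (f y) y) @ x --> B (f x) x.
  move=> cf ix; have c : (fun y => (y, f y)) @ x --> (x, f x).
    by apply: (cvg_pair2 (nbhs_filter x)); [exact: cvg_id|exact: cf].
  exact: (cvg_comp _ _ c (homotopy_mx_continuous H_continuous (t := f x) ix)).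
have cA x : dom i x -> A @ x --> A x.
  move=> ix; apply: (cvg_mulmx (nbhs_filter x)); first exact: cB.
  apply: (cvg_invmx (nbhs_filter x)); first exact: cB.
  by apply: Sp_unitmx; exact: SB.
have csA x : dom i x -> word_continuous_at (A x) s.
  move=> ix; have [E|/wA []//] := eqVneq (sigma x) (tau x).
  by rewrite A1.
move=> /(factored_word schi (fun x _ => cchi x) cA csA).
apply: factored_ext => x; rewrite /stopped.
have [ix|ix] := pselect (dom i x).
  apply/lfunP => v; apply: (can_inj (trivK ix)).
  rewrite comp_lfunE triv_chart_end // [1%:M + (_ - _)]addrC subrK.
  rewrite !triv_homotopy // mulmxA; congr (_ *m _).
  have -> : word_mx (chi x) s (A x) = A x.
    have [E|ne] := eqVneq (sigma x) (tau x); first by rewrite A1.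
    rewrite chi1 //; have [_] := wA _ ne; apply.
    by apply: SpM; [exact: SB|apply: SpV; exact: SB].
  by rewrite /A mulmxKV // Sp_unitmx //; exact: SB.
have chi0 : chi x = 0 by exact: supported_in_out ix.
have -> : sigma x = tau x.
  by apply/eqP; apply: contraT => /chi1 /eqP; rewrite chi0 eq_sym oner_eq0.
rewrite chart_end_id ?comp_lfun1l // chi0.
suff -> : forall s' : word R k, word_mx 0 s' (A x) = 1%:M by rewrite subrr.
by elim=> //= l s' ->; rewrite /letter_mx scale0r shear0 mulmx1.
Qed.

Hypothesis X_normal : normal_space X.
Hypothesis X_accessible : accessible_space X.

Lemma bump (x0 : X) (W : set X) : nbhs x0 W -> exists (g chi : X -> R),
  [/\ continuous g /\ continuous chi, forall x, 0 <= g x <= 1,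
      \forall x \near x0, g x = 1, forall x, g x != 0 -> chi x = 1
    & supported_in W chi].
Proof.
rewrite nbhsE => -[U [oU Ux0] UW].
have cU : closed (~` U) by exact: open_closedC.
have c1 : closed [set x0] by exact: accessible_closed_set1.
have dU : ~` U `&` [set x0] = set0.
  by rewrite -subset0 => y [nUy /= yx]; apply: nUy; rewrite yx.
have := (@normal_separatorP R X).1 X_normal _ _ cU c1 dU.
move=> /(uniform_separatorP (R := R)) [f [cf _ f0 f1]].
have fx0 : f x0 = 1 by apply: f1; exists x0.
have fU x : f x != 0 -> U x.
  by move=> nz; apply: contrapT => Ux; move/eqP: nz; apply; apply: f0; exists x.
have ca (a : R) : continuous (fun x => clamp (a * f x - 1)).
  move=> x; apply: (@cvg_comp _ _ _ (fun x => a * f x - 1) (@clamp R) _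
    (nbhs (a * f x - 1))); last exact: clamp_continuous.
  apply: cvgB; last exact: cvg_cst.
  by apply: cvgM; [exact: cvg_cst|exact: cf].
(* The first function vanishes for f <= 1/4 and is 1 for f >= 1/2; the second vanishes for f <= 1/8
   and is 1 for f >= 1/4. The closed support is f >= 1/8. *)
exists (fun x => clamp (4%:R * f x - 1)), (fun x => clamp (8%:R * f x - 1)).
split.
- by split; exact: ca.
- by move=> x; rewrite clamp_ge0 clamp_le1.
- have N : nbhs (f x0) [set y : R | 1 / 2%:R < y].
    by apply: open_nbhs_nbhs; split; [exact: open_gt|rewrite /= fx0; lra].
  have : nbhs x0 [set x | 1 / 2%:R < f x] := cf x0 _ N.
  by apply: filterS => x /= fx; apply: clamp_eq1; lra.
- by move=> x /clamp_neq0 fx; apply: clamp_eq1; lra.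
- exists [set x | 1 / 8%:R <= f x]; split.
  + apply: (@preimage_closed _ _ f [set y : R | 1 / 8%:R <= y]).
      by move=> x _; exact: cf.
    exact: closed_ge.
  + move=> x /= fx; apply: UW; apply: fU; apply/eqP => fx0';
      by move: fx; rewrite fx0' leNgt divr_gt0.
  + move=> x /negP; rewrite -ltNge => fx; rewrite /clamp min_r ?max_l //; lra.
Qed.

(** U can be chosen before sigma because [homotopy_mx_near] is uniform in the time. The passage from
    sigma to max(sigma, g) is cut into M equal increments, each handled by [stopped_chart_step]. *)
Lemma stopped_local_step (x0 : X) : exists U, nbhs x0 U /\
  forall sigma : X -> R, continuous sigma -> (forall x, 0 <= sigma x <= 1) ->
  factored (stopped sigma) ->
  exists tau : X -> R, [/\ continuous tau, forall x, 0 <= tau x <= 1,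
    factored (stopped tau), forall x, sigma x <= tau x
    & forall x, U x -> tau x = 1].
Proof.
pose i := chart V x0; have ix0 : dom i x0 by exact: chartP.
have [s [cs ss s1]] := shearable_id R k.
pose G := [set A | word_continuous_at A s /\ (Sp A -> word_mx 1 s A = A)].
have nG : nbhs (1%:M : 'M[R]_(k + k)) G by exact: filterI.
have cs1 : word_continuous_at 1%:M s := nbhs_singleton cs.
have [[W D] /= [nW nD] WD] :=
  homotopy_mx_near H_symplectic H_continuous ix0 nG.
have {nD}[d d0 dD] : exists2 d : R, 0 < d & forall e, `|e| < d -> D e.
  move/nbhs_ballP: nD => [d d0 dD]; exists d => // e ed; apply: dD.
  by rewrite /ball /= sub0r normrN.
have [g [chi [[cg cchi] g01 g1 chi1 schi]]] := bump nW.
exists [set x | g x = 1]; split=> // sigma csigma sigma01 fsigma.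
pose tau x := Num.max (sigma x) (g x).
have ctau : continuous tau by move=> x; apply: continuous_max; [exact: csigma|exact: cg].
have tau01 x : 0 <= tau x <= 1.
  have /andP[s0 s1'] := sigma01 x; have /andP[g0 g1'] := g01 x.
  by rewrite /tau le_max s0 ge_max s1' g1'.
have st x : sigma x <= tau x by rewrite /tau le_max lexx.
exists tau; split=> // [|x /= gx]; last first.
  by apply/eqP; rewrite eq_le; have /andP[_ ->] := tau01 x;
    rewrite /tau le_max gx lexx orbT.
have [M M0 Md] : exists2 M : nat, (0 < M)%N & M%:R^-1 < d.
  exists (Num.truncn d^-1).+1 => //; rewrite invf_plt ?posrE ?ltr0Sn //.
  exact: truncnS_gt.
pose mid m x := sigma x + m%:R / M%:R * (tau x - sigma x).
have M0' : (M%:R : R) != 0 by rewrite pnatr_eq0 -lt0n.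
have -> : tau = mid M.
  by apply/funext => x; rewrite /mid divff // mul1r addrC subrK.
have cmid m : continuous (mid m).
  move=> x; apply: cvgD; first exact: csigma.
  apply: cvgM; first exact: cvg_cst.
  by apply: cvgB; [exact: ctau|exact: csigma].
have mid01 m x : (m <= M)%N -> 0 <= mid m x <= 1.
  move=> mM; have := st x; have := sigma01 x; have := tau01 x; rewrite /mid.
  have : (m%:R / M%:R : R) <= 1 by rewrite ler_pdivrMr ?ltr0n // mul1r ler_nat.
  have : 0 <= (m%:R / M%:R : R) by rewrite divr_ge0.
  by move: (_ / _) (sigma x) (tau x) => q a b; nra.
suff step m : (m <= M)%N -> factored (stopped (mid m)) by exact: step.
elim: m => [_|m IH mM].
  by apply: factored_ext fsigma => x; rewrite /stopped /mid !mul0r addr0.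
(* The later time [mid m.+1] plays the role of t in [homotopy_mx_near], so the increment e is
   negative, of absolute value at most 1/M < d. *)
have dE x : mid m x = mid m.+1 x + - (M%:R^-1 * (tau x - sigma x)).
  by rewrite /mid -natr1; field.
have neq x : mid m x != mid m.+1 x -> g x != 0.
  apply: contra => /eqP gx; rewrite dE /tau gx max_l ?subrr ?mulr0 ?subr0 //.
  by have /andP[] := sigma01 x.
(* W lies in the chart: this is read off [homotopy_mx_near] at e = 0 and t = 0. *)
have sdom : supported_in (dom i) chi.
  have [C [cC CW C0]] := schi; exists C; split=> // x /CW Wx.
  have D0 : D 0 by apply: dD; rewrite normr0.
  have t0 : 0 <= (0 : R) <= 1 by rewrite lexx ler01.
  by have [] := WD (x, 0) (conj Wx D0) 0 t0.
apply: (stopped_chart_step s1 cs1 (cmid m) (cmid m.+1) cchi sdom _ _ (IH (ltnW mM))).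
  by move=> x /neq; exact: chi1.
move=> x ne; have Wx : W x.
  apply: contrapT => Wx; have := supported_in_out schi Wx.
  by rewrite chi1 ?neq // => /eqP; rewrite oner_eq0.
have De : D (- (M%:R^-1 * (tau x - sigma x))).
  apply: dD; rewrite normrN normrM ger0_norm ?invr_ge0 //.
  apply: le_lt_trans Md; rewrite ler_piMr ?invr_ge0 //.
  by have := st x; have := sigma01 x; have := tau01 x; rewrite ler_norml; lra.
have [_] := WD (x, _) (conj Wx De) _ (mid01 m.+1 x mM).
by rewrite /= -dE.
Qed.

Hypothesis X_compact : compact [set: X].

(** Compactness enters as an induction principle: P passes to subsets and to binary unions and holds
    near each point, hence holds for X. *)
Lemma stopped_factored : (forall x, H 0 x = \1%VF) -> factored (stopped (fun=> 1)).
Proof.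
move=> H0.
pose P (U : set X) := forall sigma : X -> R, continuous sigma ->
  (forall x, 0 <= sigma x <= 1) -> factored (stopped sigma) ->
  exists tau : X -> R, [/\ continuous tau, forall x, 0 <= tau x <= 1,
    factored (stopped tau), forall x, sigma x <= tau x
    & forall x, U x -> tau x = 1].
suff : P setT.
  move=> /(_ (fun=> 0)) [].
  - by move=> x; exact: cvg_cst.
  - by move=> x; rewrite lexx ler01.
  - apply: factored_id => x; rewrite /stopped clamp_id ?lexx ?ler01 //.
  - move=> tau [_ _ ftau _ tau1].
    by apply: factored_ext ftau => x; rewrite /stopped tau1.
have Psub U W : U `<=` W -> P W -> P U.
  move=> UW PW sigma c s01 f; have [tau [? ? ? ? t1]] := PW sigma c s01 f.
  by exists tau; split=> // x /UW; exact: t1.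
(* Monotonicity in P is used here: where the first step has reached 1, the second one stays at 1. *)
have PU U W : P U -> P W -> P (U `|` W).
  move=> PU PW sigma c s01 f; have [tau [ct t01 ft st t1]] := PU sigma c s01 f.
  have [rho [cr r01 fr tr r1]] := PW tau ct t01 ft.
  exists rho; split=> // [x|x [/t1 tx|/r1//]]; first exact: le_trans (tr x).
  apply/eqP; rewrite eq_le -{2}tx tr andbT.
  by have /andP[] := r01 x.
(* Were this filter proper, the local step at a cluster point would contradict
   its definition. *)
pose F : set_system X := [set A | P (~` A)].
have FF : Filter F.
  split.
  - by rewrite /F /= setCT => sigma c s01 f; exists sigma; split.
  - by move=> A B PA PB; rewrite /F /mkset setCI; exact: PU.
  - by move=> A B AB; apply: Psub; exact: subsetC.
have [F0|nF0] := pselect (F set0); first by rewrite /F /= setC0 in F0.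
have PF : ProperFilter F by split.
have [x [_ clx]] := X_compact PF (filterT).
have [U [nU PU0]] := stopped_local_step x.
have [|y [nUy Uy]] := clx (~` U) U _ nU; last by [].
by rewrite /F /= setCK.
Qed.

End Fragmentation.

(** * Compactness of finite CW-complexes, and the theorem *)

Lemma disk_compact (R : realType) (n : nat) : compact (disk R n).
Proof.
apply: (@subclosed_compact _ _ [set v : 'rV[R]_n | forall i, v ord0 i \in `[-1, 1]]).
- apply: (@preimage_closed _ _ (@sqnorm R n) [set x : R | x <= 1]); last exact: closed_le.
  move=> v _; apply: (cvg_big (@add_continuous R) (F := nbhs v)) => j _.
  apply: (@cvg_comp _ _ _ (fun w : 'rV[R]_n => w ord0 j) (fun x => x ^+ 2) _
    (nbhs (v ord0 j))); first exact: coord_continuous.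
  exact: exprn_continuous.
- apply: (@rV_compact R n (fun=> `[(-1 : R), 1]%classic)) => _.
  exact: segment_compact.
- move=> v /= v1 j; rewrite in_itv /= -ler_norml -(@ler_pXn2r _ 2) ?nnegrE //.
  rewrite expr1n real_normK ?num_real //; apply: le_trans v1.
  rewrite /sqnorm (bigD1 j) //= lerDl; apply: sumr_ge0 => l _; exact: sqr_ge0.
Qed.

(** Every point lies in an open cell, so X is the finite union of the images of the closed disks. *)
Lemma finite_CW_compact (R : realType) (X : topologicalType) (K : finite_CW R X) :
  compact [set: X].
Proof.
have -> : [set: X] = \big[setU/set0]_(c : cell K) (@char R X K c @` disk R (cell_dim c)).
  apply/esym/seteqP; split => // x _.
  have [c [[v vD vx] _]] := open_cells_partition K x.
  rewrite -bigcup_seq; exists c; first by rewrite /= mem_index_enum.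
  by exists v => //; exact: ltW.
apply: bigsetU_compact => c _; apply: continuous_compact.
  exact: char_continuous.
exact: disk_compact.
Qed.

Theorem theorem4 (R : realType) (X : topologicalType) (K : finite_CW R X)
    (k : nat) (V : sp_bundle R k X) (S : vb_end V)
    (hS : symplectic_automorphism S) (hS0 : nullhomotopic S) :
  (exists (N : nat) (E : nat -> vb_end V),
     (forall x, S x = vb_comp E N x) /\
     (forall j, (j < N)%N ->
        [/\ symplectic_automorphism (E j), unipotent (E j)
          & elementary (E j)])) /\
  (lagrangian V ->
   exists (N : nat) (E : nat -> vb_end V),
     (forall x, S x = vb_comp E N x) /\
     (forall j, (j < N)%N ->
        [/\ symplectic_automorphism (E j), unipotent (E j),
            elementary (E j) & respects_splitting (E j)])).
Proof.
have [H [sH cH H0 H1]] := hS0.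
have hX := CW_hausdorff K; have cX := finite_CW_compact K.
have symH t : 0 <= t <= 1 -> symplectic (H t) by move=> /sH [].
have [N [E [SE gE]]] := stopped_factored symH cH (compact_normal hX cX)
  (hausdorff_accessible hX) cX H0.
have {}SE x : S x = vb_comp E N x.
  by rewrite -SE /stopped clamp_id ?ler01 ?lexx // H1.
split=> [|LV]; exists N, E; split=> // j /gE [? ? ? rE].
- by split.
- by split => //; exact: rE.
Qed.
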